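(* Let $\mathbf{r}=(r,r')$ be a pair of cardinals $\ge 1$, $F$ be an infinite division ring of characteristic $p\ge 0$, and $V$ be a left $F$-vector space of dimension $r+r'$. Set $M_0:=\mathbb Z[\mathrm{Gr}(\mathbf{r},V)]^{\circ}$ and $G:=\mathrm{GL}_F(V)$. Then there is a sequence of nonzero right $G$-submodules $M_0\supseteq M_1\supseteq M_2\supseteq M_3\supseteq\dots$ such that (1) $M_0/M_1$ is a free abelian group, vanishing if and only if at least one of $r$ and $r'$ is finite; (2) if $p>0$ then the natural map $\mathbb Z[1/p]\otimes M_n\to\mathbb Z[1/p]\otimes M_1$ is surjective for any $n\ge 1$; (3) for any $n\ge 1$ and any field $K$, the natural map $K\otimes M_n\to K\otimes M_1$ is surjective; (4) if, for an associative unital ring $A$, an $A[G]$-submodule $M$ of $A\otimes M_0$ contains $\alpha=\sum_{i=0}^N a_i[L_i]$ (with $a_i\in A$, $L_i\in\mathrm{Gr}(\mathbf{r},V)$), where $L_0\not\subseteq\bigcup_{i=1}^N L_i$, then $M$ contains $Aa_0\otimes M_n$ for some $n$ depending on $N$.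
   Context: For a pair of cardinals $\mathbf{r}=(r,r')$ with $r+r'=\dim_F V$, $\mathrm{Gr}(\mathbf{r},V)$ denotes the set of all $F$-vector subspaces of $V$ of dimension $r$ and codimension $r'$. For an associative ring $A$, $A[\mathrm{Gr}(\mathbf{r},V)]=A\otimes\mathbb Z[\mathrm{Gr}(\mathbf{r},V)]$ is the left $A$-module of all finite formal linear combinations $\sum_j a_j[L_j]$ with $a_j\in A$, $L_j\in\mathrm{Gr}(\mathbf{r},V)$, and $A[\mathrm{Gr}(\mathbf{r},V)]^{\circ}$ is its submodule of combinations with $\sum_j a_j=0$; one has $A[\mathrm{Gr}(\mathbf{r},V)]^{\circ}=A\otimes\mathbb Z[\mathrm{Gr}(\mathbf{r},V)]^{\circ}$. The group $G=\mathrm{GL}_F(V)=\mathrm{Aut}_F(V)$ acts on $V$ (from the right), hence on the right on $\mathrm{Gr}(\mathbf{r},V)$ and, $A$-linearly, on $A[\mathrm{Gr}(\mathbf{r},V)]$. An $A[G]$-submodule is an additive subgroup stable under left multiplication of the coefficients by $A$ and under the right $G$-action. All tensor products are over $\mathbb Z$. $Aa_0\otimes M_n$ is understood as its image in $A\otimes M_0=A[\mathrm{Gr}(\mathbf{r},V)]^{\circ}$. *)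

(* Defs.v *)
From HB Require Import structures.
From mathcomp Require Export all_boot all_order all_algebra.
From mathcomp Require Export finmap.
From mathcomp Require Export boolp classical_sets functions cardinality.
From mathcomp Require Export ring_quotient.
From mathcomp Require Export monalg.

Set Implicit Arguments.
Unset Strict Implicit.
Unset Printing Implicit Defensive.

Import GRing.Theory.
Local Open Scope classical_set_scope.
Local Open Scope card_scope.
Local Open Scope ring_scope.
Local Open Scope quotient_scope.

(* The library's [submodClosed] is meant for semimodules and does not provide
   the closure under opposites that [zmodClosed] asks for. *)
Record submodule (R : pzRingType) (M : lmodType R) := Submodule {
  submod_pred :> {pred M};
  submodP : GRing.submod_closed submod_pred }.

HB.instance Definition _ (R : pzRingType) (M : lmodType R)
    (U : submodule M) :=
  GRing.isZmodClosed.Build M (submod_pred U)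
    (GRing.submod_closedB (submodP U)).
HB.instance Definition _ (R : pzRingType) (M : lmodType R)
    (U : submodule M) :=
  GRing.isScaleClosed.Build R M (submod_pred U)
    (GRing.subsemimod_closedZ (GRing.submod_closed_semi (submodP U))).

Record sub_of (T : choiceType) (P : {pred T}) :=
  SubOf { sub_val :> T; sub_valP : sub_val \in P }.

HB.instance Definition _ (T : choiceType) (P : {pred T}) :=
  [isSub for @sub_val T P].
HB.instance Definition _ (T : choiceType) (P : {pred T}) :=
  [Choice of sub_of P by <:].
HB.instance Definition _ (M : zmodType) (U : zmodClosed M) :=
  [SubChoice_isSubZmodule of sub_of U by <:].
HB.instance Definition _ (R : pzRingType) (M : lmodType R)
    (U : submodule M) :=
  GRing.SubZmodule_isSubLmodule.Build R M _ (sub_of U)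
    (GRing.subsemimodClosedP _).

Definition sub_incl (T : choiceType) (P Q : {pred T})
    (PQ : {subset P <= Q}) (x : sub_of P) : sub_of Q :=
  SubOf (PQ _ (sub_valP x)).

Lemma sub_incl_additive (M : zmodType) (U W : zmodClosed M)
    (UW : {subset U <= W}) :
  zmod_morphism (sub_incl UW : sub_of U -> sub_of W).
Proof. by move=> x y; apply: val_inj. Qed.

(* W :&: U as a subset of U *)
Definition sub_in (T : choiceType) (U W : {pred T}) : {pred sub_of U} :=
  [pred x | sub_val x \in W].
Arguments sub_in {T} U W.

Fact sub_in_closed (M : zmodType) (U W : zmodClosed M) :
  zmod_closed (sub_in U W).
Proof.
split=> [|x y]; rewrite !inE; first exact: rpred0.
by move=> xW yW; apply: rpredB.
Qed.

HB.instance Definition _ (M : zmodType) (U W : zmodClosed M) :=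
  GRing.isZmodClosed.Build (sub_of U) (sub_in U W) (sub_in_closed U W).

(* The library puts a group structure on this quotient; the module structure
   for a submodule U is added below. *)
Definition quot (M : zmodType) (U : zmodClosed M) : Type := Quotient.quot U.

HB.instance Definition _ (M : zmodType) (U : zmodClosed M) :=
  GRing.Zmodule.on (quot U).

Definition proj (M : zmodType) (U : zmodClosed M) (x : M) : quot U :=
  \pi_(Quotient.quot U) x.

Definition quot_repr (M : zmodType) (U : zmodClosed M) (x : quot U) : M :=
  repr (x : Quotient.quot U).

Section QuotientGroup.
Variables (M : zmodType) (U : zmodClosed M).

Lemma quot_reprK : cancel (@quot_repr M U) (@proj M U).
Proof. exact: reprK. Qed.

Lemma proj_is_additive : zmod_morphism (@proj M U).
Proof. by move=> x y; rewrite /proj raddfB. Qed.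

HB.instance Definition _ :=
  GRing.isZmodMorphism.Build M (quot U) (@proj M U) proj_is_additive.

Lemma proj_eqP (x y : M) : reflect (proj U x = proj U y) (x - y \in U).
Proof. by rewrite Quotient.idealrBE; apply: eqP. Qed.

End QuotientGroup.

Section QuotientModule.
Variables (R : pzRingType) (M : lmodType R) (U : submodule M).

Definition quot_scale (a : R) (x : quot U) : quot U :=
  proj U (a *: quot_repr x).

Lemma quot_scaleE a x : quot_scale a (proj U x) = proj U (a *: x).
Proof.
apply/proj_eqP; rewrite -scalerBr; apply: rpredZ.
by apply/proj_eqP; rewrite quot_reprK.
Qed.

Fact quot_scaleA a b x : quot_scale a (quot_scale b x) = quot_scale (a * b) x.
Proof. by rewrite -[x]quot_reprK !quot_scaleE scalerA. Qed.

Fact quot_scale1 : left_id 1 quot_scale.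
Proof. by move=> x; rewrite -[x]quot_reprK quot_scaleE scale1r. Qed.

Fact quot_scaleDr : right_distributive quot_scale +%R.
Proof.
move=> a x y; rewrite -[x]quot_reprK -[y]quot_reprK -raddfD !quot_scaleE.
by rewrite scalerDr raddfD.
Qed.

Fact quot_scaleDl x : {morph quot_scale^~ x : a b / a + b}.
Proof.
by move=> a b; rewrite -[x]quot_reprK !quot_scaleE scalerDl raddfD.
Qed.

HB.instance Definition _ := GRing.Zmodule_isLmodule.Build R (quot U)
  quot_scaleA quot_scale1 quot_scaleDr quot_scaleDl.

End QuotientModule.

Definition is_basis (R : pzRingType) (M : lmodType R) (B : set M) : Prop :=
  (forall (s : seq M) (c : M -> R), uniq s -> [set` s] `<=` B ->
     \sum_(v <- s) c v *: v = 0 -> forall v, v \in s -> c v = 0) /\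
  (forall x : M, exists (s : seq M) (c : M -> R),
     [set` s] `<=` B /\ x = \sum_(v <- s) c v *: v).

(* A cardinal is given by a type having that many elements: dim M = r iff M
   has a basis equipotent to r. *)
Definition has_dim (R : pzRingType) (M : lmodType R) (r : Type) : Prop :=
  exists2 B : set M, is_basis B & B #= [set: r].

(* [zmodule X] is the library's alias carrying the Z-module structure. *)
Definition free_abelian (X : zmodType) : Prop :=
  exists B : set (zmodule X), is_basis B.

Lemma has_dim_iso (R : pzRingType) (M N : lmodType R) (f : {linear M -> N})
    (r : Type) : bijective f -> has_dim M r -> has_dim N r.
Proof.
move=> [g fK gK] [B [freeB spanB] Br].
have fI : injective f := can_inj fK.
exists (f @` B); last first.
  by apply: card_eq_trans Br; apply: inj_card_eq => x y _ _; apply: fI.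
split=> [s c us sB sc0 v vs|y].
  have sE : s = map f (map g s).
    by rewrite -map_comp -[LHS]map_id; apply: eq_map => x /=; rewrite gK.
  have gs : uniq (map g s) by rewrite map_inj_uniq //; apply: can_inj gK.
  have gsB : [set` map g s] `<=` B.
    move=> _ /= /mapP[w ws ->]; have [x Bx <-] := sB w ws.
    by rewrite fK.
  have := freeB (map g s) (c \o f) gs gsB.
  have -> : \sum_(x <- map g s) (c \o f) x *: x = 0.
    apply: fI; rewrite linear0 linear_sum big_map -[RHS]sc0.
    by apply: eq_bigr => x _; rewrite linearZ /= gK.
  by move=> /(_ erefl (g v) (map_f g vs)); rewrite /= gK.
have [s [c [sB gy]]] : exists (s : seq M) (c : M -> R),
    [set` s] `<=` B /\ g y = \sum_(v <- s) c v *: v by apply: spanB.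
exists (map f s), (c \o g); split.
  by move=> _ /= /mapP[w ws ->]; exists w => //; apply: sB.
rewrite -[LHS]gK gy linear_sum big_map; apply: eq_bigr => x _.
by rewrite linearZ /= fK.
Qed.

(* A[T], the finite formal combinations of elements of T with coefficients in
   A, is {malg A[T]}; the term a[t] is << a *g t >>. *)

(* sum_j a_j [t_j] |-> sum_j f t_j a_j *)
Definition malg_ext (T : choiceType) (A B : zmodType) (f : T -> A -> B)
    (x : {malg A[T]}) : B :=
  \sum_(t <- msupp x) f t (x@_t).

Lemma malg_extEw (T : choiceType) (A B : zmodType) (f : T -> A -> B)
    (d : {fset T}) (x : {malg A[T]}) :
  (forall t, f t 0 = 0) -> (msupp x `<=` d)%fset ->
  malg_ext f x = \sum_(t <- d) f t (x@_t).
Proof.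
move=> f0 xd; rewrite /malg_ext; apply: big_fset_incl => // t _ tx.
by rewrite mcoeff_outdom.
Qed.

Lemma malg_ext_is_additive (T : choiceType) (A B : zmodType)
    (f : T -> A -> B) :
  (forall t, zmod_morphism (f t)) -> zmod_morphism (malg_ext f).
Proof.
move=> fB x y.
have f0 t : f t 0 = 0 by rewrite -[0 in LHS](subrr 0) fB subrr.
pose d := (msupp x `|` msupp y)%fset.
rewrite (@malg_extEw _ _ _ f d) ?msuppB_le //.
rewrite (@malg_extEw _ _ _ f d x) ?fsubsetUl //.
rewrite (@malg_extEw _ _ _ f d y) ?fsubsetUr // -sumrB.
by apply: eq_bigr => t _; rewrite mcoeffB fB.
Qed.

Lemma malg_extU (T : choiceType) (A B : zmodType) (f : T -> A -> B) a t :
  f t 0 = 0 -> malg_ext f << a *g t >> = f t a.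
Proof.
move=> f0; rewrite /malg_ext msuppU; case: eqP => [->|_].
  by rewrite big_seq_fset0 f0.
by rewrite big_seq_fset1 mcoeffUU.
Qed.

(* sum_j a_j [t_j] |-> sum_j a_j *)
Definition degree (T : choiceType) (A : zmodType) (x : {malg A[T]}) : A :=
  malg_ext (fun _ a => a) x.

(* A[T]^o *)
Definition degree0 (T : choiceType) (A : zmodType) : {pred {malg A[T]}} :=
  [pred x | degree x == 0].

(* left multiplication of the coefficients by c *)
Definition coef_mul (T : choiceType) (A : pzRingType) (c : A)
    (x : {malg A[T]}) : {malg A[T]} :=
  malg_ext (fun t a => << c * a *g t >>) x.

Definition fgen (T : choiceType) (t : T) : {malg int[T]} := << 1 *g t >>.

(* The tensor product over Z: the free abelian group on A * B modulo the
   subgroup generated by the biadditivity relations. *)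
Definition tensor_rel (A B : zmodType) : {pred {malg int[(A * B)%type]}} :=
  [pred x | `[< forall U : zmodClosed {malg int[(A * B)%type]},
    (forall a a' b, fgen (a + a', b) - fgen (a, b) - fgen (a', b) \in U) ->
    (forall a b b', fgen (a, b + b') - fgen (a, b) - fgen (a, b') \in U) ->
    x \in U >]].

Fact tensor_rel_closed (A B : zmodType) : zmod_closed (@tensor_rel A B).
Proof.
split=> [|x y]; rewrite !inE.
  by move=> U _ _; apply: rpred0.
move=> xR yR U Ul Ur.
by apply: rpredB; [apply: xR | apply: yR].
Qed.

HB.instance Definition _ (A B : zmodType) :=
  GRing.isZmodClosed.Build _ (@tensor_rel A B) (@tensor_rel_closed A B).

Definition tensor (A B : zmodType) : Type := quot (@tensor_rel A B).

HB.instance Definition _ (A B : zmodType) := GRing.Zmodule.on (tensor A B).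

Definition tens (A B : zmodType) (a : A) (b : B) : tensor A B :=
  proj (@tensor_rel A B) (fgen (a, b)).

(* the map a (x) b |-> h a b induced by a biadditive h *)
Definition tensor_lift (A B C : zmodType) (h : A -> B -> C)
    (t : tensor A B) : C :=
  malg_ext (fun ab (k : int) => h ab.1 ab.2 *~ k)
    (quot_repr (t : quot (@tensor_rel A B))).

Definition biadditive (A B C : zmodType) (h : A -> B -> C) : Prop :=
  (forall b, zmod_morphism (h^~ b)) /\ (forall a, zmod_morphism (h a)).

(* C (x) A -> C (x) B, induced by f : A -> B *)
Definition tensor_map (C A B : zmodType) (f : A -> B) :
    tensor C A -> tensor C B :=
  tensor_lift (fun c a => tens c (f a)).

Section TensorTheory.
Variables A B : zmodType.

Lemma tens_biadditive : biadditive (@tens A B).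
Proof.
have tD1 a a' b : tens (a + a') b = tens a b + tens a' b :> tensor A B.
  rewrite -[RHS]raddfD; apply/proj_eqP; rewrite opprD addrA inE.
  by move=> U Ul Ur.
have tD2 a b b' : tens a (b + b') = tens a b + tens a b' :> tensor A B.
  rewrite -[RHS]raddfD; apply/proj_eqP; rewrite opprD addrA inE.
  by move=> U Ul Ur.
split=> [b x y|a x y]; apply/eqP; rewrite eq_sym subr_eq.
  by rewrite -tD1 subrK.
by rewrite -tD2 subrK.
Qed.

Variables (C : zmodType) (h : A -> B -> C) (hP : biadditive h).

Let hfree (x : {malg int[(A * B)%type]}) : C :=
  malg_ext (fun ab (k : int) => h ab.1 ab.2 *~ k) x.

Let hfree_additive : zmod_morphism hfree.
Proof. by apply: malg_ext_is_additive => ab k l; rewrite mulrzBr. Qed.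

Let hfreeU a b : hfree (fgen (a, b)) = h a b.
Proof. by rewrite /hfree /fgen malg_extU. Qed.

Let hker : {pred {malg int[(A * B)%type]}} := [pred x | hfree x == 0].

Let hfree0 : hfree 0 = 0.
Proof. by have := hfree_additive 0 0; rewrite !subrr. Qed.

Let hker_closed : zmod_closed hker.
Proof.
split=> [|x y]; rewrite ?inE; first by rewrite hfree0.
by move=> /eqP x0 /eqP y0; rewrite hfree_additive x0 y0 subrr.
Qed.

Lemma tensor_lift_pi x :
  tensor_lift h (proj (@tensor_rel A B) x) = hfree x.
Proof.
set y := quot_repr (proj (@tensor_rel A B) x).
suff : hfree (y - x) = 0.
  by rewrite hfree_additive => /eqP; rewrite subr_eq0 => /eqP.
have : y - x \in @tensor_rel A B.
  by apply/proj_eqP; rewrite /y quot_reprK.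
have [hl hr] := hP.
have morphD (X Y : zmodType) (f : X -> Y) :
    zmod_morphism f -> {morph f : u v / u + v}.
  move=> fB u v; have f0 : f 0 = 0 by rewrite -[0 in LHS](subrr 0) fB subrr.
  by rewrite -{1}[v]opprK fB -[- v]sub0r fB f0 sub0r opprK.
rewrite inE => yxR.
pose K : zmodClosed {malg int[(A * B)%type]} := HB.pack hker
  (GRing.isZmodClosed.Build _ hker hker_closed).
suff : y - x \in K by move/eqP.
apply: yxR => [a a' b|a b b']; apply/eqP.
  by rewrite !hfree_additive !hfreeU (morphD _ _ _ (hl b)) addrAC addrK subrr.
by rewrite !hfree_additive !hfreeU (morphD _ _ _ (hr a)) addrAC addrK subrr.
Qed.

Lemma tensor_liftE a b : tensor_lift h (tens a b) = h a b.
Proof. by rewrite tensor_lift_pi hfreeU. Qed.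

Lemma tensor_lift_additive : zmod_morphism (tensor_lift h).
Proof.
move=> t u; rewrite -[t]quot_reprK -[u]quot_reprK.
rewrite -(raddfB (proj (@tensor_rel A B))).
by rewrite !tensor_lift_pi hfree_additive.
Qed.

End TensorTheory.

Lemma tensor_map_biadditive (C A B : zmodType) (f : A -> B) :
  zmod_morphism f -> biadditive (fun (c : C) a => tens c (f a)).
Proof.
have [tl tr] := tens_biadditive C B.
by move=> fB; split=> [a x y|c x y] /=; [rewrite tl | rewrite fB tr].
Qed.

Lemma tensor_mapE (C A B : zmodType) (f : A -> B) (c : C) (a : A) :
  zmod_morphism f -> tensor_map f (tens c a) = tens c (f a).
Proof. by move=> fB; rewrite /tensor_map tensor_liftE //; apply: tensor_map_biadditive. Qed.

(* Z[1/p] inside the rationals *)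
Definition Zinv (p : nat) : {pred rat} :=
  [pred x | `[< exists k : nat, x * p%:R ^+ k \is a Num.int >]].

Fact Zinv_closed (p : nat) : zmod_closed (Zinv p).
Proof.
split=> [|x y]; rewrite !inE.
  by exists 0%N; rewrite mul0r.
move=> [k xk] [l yl]; exists (k + l)%N.
rewrite exprD mulrBl mulrA mulrCA [_ * (y * _)]mulrC.
have pZ m : (p%:R : rat) ^+ m \is a Num.int by rewrite rpredX ?rpred_nat.
by apply: rpredB; apply: rpredM.
Qed.

HB.instance Definition _ (p : nat) :=
  GRing.isZmodClosed.Build rat (Zinv p) (Zinv_closed p).

Record Gr (F : pzRingType) (r r' : Type) (V : lmodType F) := MkGr {
  gr_space : submodule V;
  gr_dim : @has_dim F (sub_of gr_space) r;
  gr_codim : @has_dim F (quot gr_space) r' }.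

HB.instance Definition _ (F : pzRingType) (r r' : Type) (V : lmodType F) :=
  gen_eqMixin (Gr r r' V).
HB.instance Definition _ (F : pzRingType) (r r' : Type) (V : lmodType F) :=
  gen_choiceMixin (Gr r r' V).

Lemma gr_eqP (F : pzRingType) (r r' : Type) (V : lmodType F)
    (L L' : Gr r r' V) : gr_space L =i gr_space L' -> L = L'.
Proof.
case: L L' => [[P Pm] d c] [[P' Pm'] d' c'] /= PP'.
have {}PP' : P = P' by apply: funext => x; apply: PP'.
case: _ / PP' Pm' d' c' => Pm' d' c'.
case: _ / (Prop_irrelevance Pm Pm') d' c' => d' c'.
by congr MkGr; apply: Prop_irrelevance.
Qed.

(* Aut_F(V) *)
Record GL (F : pzRingType) (V : lmodType F) := MkGL {
  gl_fun :> {linear V -> V};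
  gl_bij : bijective gl_fun }.

Section Action.
Variables (F : pzRingType) (V : lmodType F) (g : GL V) (U : submodule V).

Definition gl_image : {pred V} := [pred v | `[< exists2 u, u \in U & g u = v >]].

Lemma gl_imageP v : reflect (exists2 u, u \in U & g u = v) (v \in gl_image).
Proof. exact: asboolP. Qed.

Fact gl_image_closed : GRing.submod_closed gl_image.
Proof.
split; first by apply/gl_imageP; exists 0; rewrite ?rpred0 ?raddf0.
move=> a _ _ /gl_imageP[u uU <-] /gl_imageP[v vU <-].
apply/gl_imageP; exists (a *: u + v); last by rewrite linearP.
by apply: rpredD => //; apply: rpredZ.
Qed.

Definition gl_space : submodule V := Submodule gl_image_closed.

Lemma mem_gl_space v : (g v \in gl_space) = (v \in U).
Proof.
apply/gl_imageP/idP => [[u uU /(bij_inj (gl_bij g)) <-] //|vU].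
by exists v.
Qed.

Let fsub (x : sub_of U) : sub_of gl_space :=
  @SubOf _ gl_space (g (sub_val x)) (etrans (mem_gl_space _) (sub_valP x)).

Let fsub_linear : linear fsub.
Proof. by move=> a x y; apply: val_inj; rewrite /= linearP. Qed.

Lemma gl_dim r : @has_dim F (sub_of U) r -> @has_dim F (sub_of gl_space) r.
Proof.
pose f : {linear sub_of U -> sub_of gl_space} :=
  HB.pack fsub (GRing.isLinear.Build F _ _ _ fsub fsub_linear).
apply: (@has_dim_iso _ _ _ f).
have [h gK hK] := gl_bij g.
have hP (y : sub_of gl_space) : h (sub_val y) \in U.
  by rewrite -mem_gl_space hK (sub_valP y).
exists (fun y => SubOf (hP y)) => x; apply: val_inj => /=; first exact: gK.
exact: hK.
Qed.

Let fquot (x : quot U) : quot gl_space := proj gl_space (g (quot_repr x)).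

Let fquotE x : fquot (proj U x) = proj gl_space (g x).
Proof.
apply/proj_eqP; rewrite -raddfB mem_gl_space.
by apply/proj_eqP; rewrite quot_reprK.
Qed.

Let fquot_linear : linear fquot.
Proof.
move=> a x y; rewrite -[x]quot_reprK -[y]quot_reprK.
have sc (W : submodule V) b u : b *: proj W u = proj W (b *: u).
  exact: quot_scaleE.
by rewrite sc -raddfD !fquotE sc -raddfD linearP.
Qed.

Lemma gl_codim r : @has_dim F (quot U) r -> @has_dim F (quot gl_space) r.
Proof.
pose f : {linear quot U -> quot gl_space} :=
  HB.pack fquot (GRing.isLinear.Build F _ _ _ fquot fquot_linear).
apply: (@has_dim_iso _ _ _ f).
have [h gK hK] := gl_bij g.
exists (fun y => proj U (h (quot_repr y))) => x.
  rewrite -[RHS]quot_reprK; apply/proj_eqP.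
  rewrite -mem_gl_space linearB hK; apply/proj_eqP.
  by rewrite quot_reprK.
by rewrite /= fquotE hK quot_reprK.
Qed.

End Action.

(* G acts on V, hence on Gr, from the right: v g is the value of g at v. *)
Definition gr_act (F : pzRingType) (r r' : Type) (V : lmodType F)
    (L : Gr r r' V) (g : GL V) : Gr r r' V :=
  MkGr (gl_dim g (gr_dim L)) (gl_codim g (gr_codim L)).

Definition gr_mod_act (F : pzRingType) (r r' : Type) (V : lmodType F)
    (A : zmodType) (x : {malg A[Gr r r' V]}) (g : GL V) :
    {malg A[Gr r r' V]} :=
  malg_ext (fun L a => << a *g gr_act L g >>) x.

Definition GL_stable (F : pzRingType) (r r' : Type) (V : lmodType F)
    (A : zmodType) (M : {pred {malg A[Gr r r' V]}}) : Prop :=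
  forall (g : GL V) x, x \in M -> gr_mod_act x g \in M.

(* A[G]-submodules of A (x) M_0, identified with A[Gr]^o as M_0 = Z[Gr]^o *)
Definition AG_submodule (F : pzRingType) (r r' : Type) (V : lmodType F)
    (A : pzRingType) (M : zmodClosed {malg A[Gr r r' V]}) : Prop :=
  [/\ {subset M <= @degree0 _ A},
      forall (c : A) x, x \in M -> coef_mul c x \in M
    & GL_stable M].

Definition left_ideal (A : pzRingType) (a : A) : {pred A} :=
  [pred x | `[< exists c : A, x = c * a >]].

Fact left_ideal_closed (A : pzRingType) (a : A) : zmod_closed (left_ideal a).
Proof.
split=> [|x y]; rewrite !inE; first by exists 0; rewrite mul0r.
by move=> [c ->] [d ->]; exists (c - d); rewrite mulrBl.
Qed.

HB.instance Definition _ (A : pzRingType) (a : A) :=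
  GRing.isZmodClosed.Build A (left_ideal a) (left_ideal_closed a).

(* The natural map I (x) N -> A[T] for subgroups I of A and N of Z[T]:
   b (x) sum_j k_j [t_j] |-> sum_j (k_j b) [t_j] *)
Definition tensor_to_malg (A : pzRingType) (T : choiceType)
    (I : zmodClosed A) (N : zmodClosed {malg int[T]}) :
    tensor (sub_of I) (sub_of N) -> {malg A[T]} :=
  tensor_lift (fun (b : sub_of I) (m : sub_of N) =>
    malg_ext (fun t (k : int) => << sub_val b *~ k *g t >>) (sub_val m)).

Lemma tensor_to_malgE (A : pzRingType) (T : choiceType) (I : zmodClosed A)
    (N : zmodClosed {malg int[T]}) (b : sub_of I) (m : sub_of N) :
  tensor_to_malg (tens b m) =
  malg_ext (fun t (k : int) => << sub_val b *~ k *g t >>) (sub_val m).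
Proof.
apply: tensor_liftE; split=> [{}m x y|{}b x y] /=.
  rewrite /malg_ext -sumrB; apply: eq_bigr => t _.
  by rewrite mulrzBl monalgUB.
by apply: malg_ext_is_additive => t k l; rewrite mulrzBr monalgUB.
Qed.

Lemma chain_subset (X : zmodType) (M : nat -> zmodClosed X) :
  (forall n, {subset M n.+1 <= M n}) ->
  forall m n, (m <= n)%N -> {subset M n <= M m}.
Proof.
move=> Mdec m n; elim: n => [|n IHn]; first by rewrite leqn0 => /eqP->.
by rewrite leq_eqVlt => /predU1P[-> //|/IHn sub x /Mdec]; apply: sub.
Qed.

(* Main.v *)
From HB Require Import structures.
Require Import Defs.
From mathcomp Require Import all_boot all_order all_algebra.
From mathcomp Require Import boolp classical_sets functions cardinality.
From Stdlib Require Import Relation_Operators.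

Import GRing.Theory.
Local Open Scope classical_set_scope.
Local Open Scope ring_scope.

Set Implicit Arguments.
Unset Strict Implicit.
Unset Printing Implicit Defensive.

(** Take M_n = M_1 for every n >= 1, where M_1 is spanned by the differences
[L] - [L t] with t a reflection, that is, an automorphism of the form
w |-> w + th(w) u for a functional th and a vector u.  Say that two subspaces
are linked when a chain of reflections leads from one to the other; then M_1 is
the kernel of the map Z[Gr] -> Z[Gr/linked], and (2) and (3) are immediate.

For (4), let alpha = sum_i a_i [L_i] lie in M, and let v be a vector of L_0 that
lies in no other L_i.  For i >= 1 there is a functional y_i with y_i(v) = 1 and
y_i = 0 on L_i; put y_0 = th, a functional with th(v) = 1.  As F is infinite,
there are scalars mu_i none of whose nonempty subset sums mu_I vanishes, so
that for nonempty I the map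

   g_I : w |-> w + (sum_(i in I) y_i(w) mu_i - th(w)) v

is an automorphism (it multiplies v by mu_I).  It stabilizes L_0, which contains
v, and L_i g_I does not change when i is added to I, because y_i = 0 on L_i.
In the alternating sum of alpha g_I over nonempty I the subsets therefore cancel
in pairs, save for the singleton I = {i} whose partner is empty
([alternating_sum_toggle]): up to sign the result is a_0 [L_0] plus the sum over
i >= 1 of a_i [P_i], where P_i = L_i g_{i} is contained in ker th.  A reflection
t : w |-> w + th(w) u fixes every such P_i, so M contains a_0 ([L_0] - [L_0 t])
([extract_reflection]).
Since G permutes transitively the pairs of a subspace and a nonzero vector in
it, L_0 and v can be moved anywhere beforehand, so M contains
a_0 ([L] - [L t]) for all L and t ([extract_linked]), hence a_0 M_1.

For (1), the quotient M_0/M_1 is the degree 0 part of Z[Gr/linked], which is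
free, and it vanishes exactly when all subspaces are linked.  If r or r' is
finite, an automorphism carrying L to L' can be corrected by one reflection for
each basis vector of L', or of V/L' ([linked_finite_dim],
[linked_finite_codim]).  A chain of reflections moves a subspace within a
finite-dimensional enlargement of it ([linked_almost_contains]), which an
automorphism need not do when r and r' are both infinite ([unlinked_exist]).

Bases are handled through their coordinate functionals ([dual_basis]). *)

(** * Dual bases *)

Lemma card_eq_bij (T U : Type) (A : set T) (B : set U) (u : U) :
  (A #= B)%card -> exists f : T -> U, set_bij A B f.
Proof.
pose U' : pointedType := HB.pack U (gen_eqMixin U) (gen_choiceMixin U)
  (isPointed.Build U u).
exact: (@card_set_bijP T U' A B).
Qed.

(** A basis together with its coordinate functionals; [R^o] is [R] as a left
module over itself.  Unlike [is_basis], this form is easy to transport to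
subspaces and quotients, and it gives functionals directly. *)
Definition dual_basis (R : nzRingType) (M : lmodType R) (I : choiceType)
    (b : I -> M) (k : I -> {linear M -> R^o}) : Prop :=
  [/\ forall i j, k i (b j) = (i == j)%:R,
      forall x, exists s : seq I, forall i, k i x != 0 -> i \in s
    & forall x, (forall i, k i x = 0) -> x = 0].

Lemma big_undup_scale (R : pzRingType) (M : lmodType R) (s : seq M)
    (c : M -> R) :
  \sum_(v <- s) c v *: v =
  \sum_(v <- undup s) (c v *+ count_mem v s) *: v.
Proof.
rewrite -big_undup_iterop_count; apply: eq_bigr => v _.
by rewrite Monoid.iteropE iter_addr_0 scalerMnl.
Qed.

Lemma big_scale_widen (R : pzRingType) (M : lmodType R) (s t : seq M)
    (c : M -> R) :
  uniq s -> uniq t -> {subset s <= t} ->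
  \sum_(v <- s) c v *: v = \sum_(v <- t) (if v \in s then c v else 0) *: v.
Proof.
move=> us ut st; rewrite [RHS](bigID [in s]) /=.
rewrite [X in _ + X]big1 ?addr0 => [|v /negPf ->]; last by rewrite scale0r.
rewrite -[RHS]big_filter; under [RHS]eq_big_seq => v.
  by rewrite mem_filter => /andP[-> _]; over.
apply: perm_big; apply: uniq_perm; rewrite ?filter_uniq // => v.
by rewrite mem_filter; case: (boolP (v \in s)) => // /st ->.
Qed.

Section DualBasis.
Variables (R : nzRingType) (M : lmodType R) (I : choiceType).

(** The coordinates of a vector are read off any expression in terms of the
basis, and linear independence makes them well defined. *)
Lemma dual_of_has_dim : has_dim M I ->
  exists (b : I -> M) (k : I -> {linear M -> R^o}), dual_basis b k.
Proof.
move=> [B [freeB spanB] BI].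
have [f [fB finj fsurj]] : exists f : I -> M, set_bij [set: I] B f.
  by apply: (card_eq_bij 0); rewrite card_eq_sym.
have fI : injective f by move=> x y; apply: finj; rewrite inE.
pose repr_of x (t : seq M * (M -> R)) :=
  [/\ uniq t.1, [set` t.1] `<=` B & x = \sum_(v <- t.1) t.2 v *: v].
have repr_ex x : exists t, repr_of x t.
  have [s [c [sB ->]]] := spanB x.
  exists (undup s, fun v => c v *+ count_mem v s); split=> /=.
  - exact: undup_uniq.
  - by move=> v /=; rewrite mem_undup; apply: sB.
  - exact: big_undup_scale.
have [rp rpP] := choice repr_ex.
pose crd x v := if v \in (rp x).1 then (rp x).2 v else 0.
(* crd x can be computed from any expression of x *)
have crdE x s (c : M -> R) : uniq s -> [set` s] `<=` B ->
    x = \sum_(v <- s) c v *: v -> forall v, v \in s -> crd x v = c v.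
  move=> us sB xE v vs; have [ut tB xE'] := rpP x.
  pose w := undup (s ++ (rp x).1).
  have uw : uniq w by apply: undup_uniq.
  have wB : [set` w] `<=` B.
    by move=> u /=; rewrite mem_undup mem_cat => /orP[/sB|/tB].
  have := freeB w (fun u => (if u \in s then c u else 0) - crd x u) uw wB.
  have -> : \sum_(u <- w) ((if u \in s then c u else 0) - crd x u) *: u = 0.
    under eq_bigr do rewrite scalerBl.
    rewrite sumrB -big_scale_widen // => [|u us']; last first.
      by rewrite mem_undup mem_cat us'.
    rewrite -xE -big_scale_widen // => [|u us']; last first.
      by rewrite mem_undup mem_cat us' orbT.
    by rewrite -xE' subrr.
  have vw : v \in w by rewrite mem_undup mem_cat vs.
  by move=> /(_ erefl v vw); rewrite vs => /eqP; rewrite subr_eq0 => /eqP ->.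
have crd_lin v : B v -> linear (fun x => crd x v : R^o).
  move=> Bv a x y; have [ut tB xE] := rpP x; have [ut' tB' yE] := rpP y.
  pose w := undup (v :: (rp x).1 ++ (rp y).1).
  have vw : v \in w by rewrite mem_undup inE eqxx.
  rewrite (@crdE _ w (fun u => a * crd x u + crd y u)) ?undup_uniq //.
    move=> u /=; rewrite mem_undup inE mem_cat.
    by move=> /orP[/eqP -> //|/orP[/tB|/tB']].
  under eq_bigr do rewrite scalerDl -scalerA.
  rewrite big_split /= -scaler_sumr -!big_scale_widen ?undup_uniq // -?xE -?yE //.
    by move=> u us; rewrite mem_undup inE mem_cat us !orbT.
  by move=> u us; rewrite mem_undup inE mem_cat us !orbT.
have fBi i : B (f i) by apply: fB.
pose k i : {linear M -> R^o} := HB.pack (fun x => crd x (f i) : R^o)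
  (GRing.isLinear.Build R M R^o _ (fun x => crd x (f i) : R^o)
     (crd_lin _ (fBi i))).
have kE i x : k i x = crd x (f i) by [].
exists f, k; split=> [i j|x|x x0].
- rewrite kE; have [<-|ij] := eqVneq i j.
    rewrite (@crdE _ [:: f i] (fun=> 1)) ?inE //.
      by move=> u /=; rewrite inE => /eqP ->.
    by rewrite big_seq1 scale1r.
  rewrite (@crdE _ [:: f i; f j] (fun u => (u == f j)%:R)) ?inE ?eqxx //=.
  + by rewrite (inj_eq fI) (negPf ij).
  + by rewrite inE andbT (inj_eq fI).
  + by move=> u /=; rewrite !inE => /orP[]/eqP->.
  + rewrite !big_cons big_nil eqxx scale1r addr0 (inj_eq fI) (negPf ij).
    by rewrite scale0r add0r.
- have [ut tB xE] := rpP x.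
  have [s sE] : exists s, map f s = (rp x).1.
    elim: (rp x).1 tB => [|v t IHt] tB'; first by exists [::].
    have [|s <-] := IHt.
      by move=> u ut'; apply: tB'; rewrite /= inE ut' orbT.
    have [|i _ <-] := fsurj v; first by apply: tB'; rewrite /= inE eqxx.
    by exists (i :: s).
  exists s => i; rewrite kE /crd -sE; case: ifP => [|_]; last by rewrite eqxx.
  by move=> /mapP[j js /fI ->].
- have [ut tB ->] := rpP x; rewrite big_seq big1 // => v vt.
  have [i _ iv] := fsurj v (tB v vt).
  by have := x0 i; rewrite kE iv /crd vt => ->; rewrite scale0r.
Qed.

Variables (b : I -> M) (k : I -> {linear M -> R^o}).
Hypothesis bk : dual_basis b k.

Lemma dual_expand x (s : seq I) : uniq s -> (forall i, k i x != 0 -> i \in s) ->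
  x = \sum_(i <- s) (k i x : R) *: b i.
Proof.
have [kb _ sep] := bk => us sP; apply/eqP; rewrite -subr_eq0; apply/eqP.
apply: sep => j; rewrite raddfB raddf_sum /=.
under eq_bigr => i _ do rewrite linearZ /= kb.
case: (boolP (j \in s)) => js.
  rewrite (bigD1_seq j) //= eqxx big1 ?addr0 => [|i /negPf ij].
    by rewrite /GRing.scale /= mulr1 subrr.
  by rewrite eq_sym ij scaler0.
rewrite big_seq big1 ?subr0 => [|i si]; first by apply/eqP/(contraNT _ js)/sP.
by have [ji|] := eqVneq j i; [rewrite ji si in js | rewrite scaler0].
Qed.

Lemma dual_supp x : exists2 s : seq I, uniq s & forall i, k i x != 0 -> i \in s.
Proof.
have [_ /(_ x)[s sP] _] := bk; exists (undup s); first exact: undup_uniq.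
by move=> i; rewrite mem_undup; apply: sP.
Qed.

Lemma has_dim_of_dual : has_dim M I.
Proof.
have [kb fin sep] := bk.
have bI : injective b.
  move=> i j bij; apply/eqP; have := kb i j.
  by rewrite -bij kb eqxx; case: eqVneq => // _ /eqP; rewrite oner_eq0.
exists (range b); last first.
  apply: card_eq_trans (inj_card_eq (fun x y _ _ => bI x y)) _.
  exact: card_eqxx.
split=> [s c us sB sc0 v vs|x].
  have [i _ bi] := sB v vs; have := congr1 (k i) sc0.
  rewrite raddf0 raddf_sum (bigD1_seq v) //= -[X in k i (_ *: X)]bi linearZ /= kb.
  rewrite eqxx big_seq_cond big1 => [|w /andP[ws wv]].
    by rewrite addr0 /GRing.scale /= mulr1.
  have [j _ bj] := sB w ws; rewrite linearZ /= -bj kb.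
  case: eqP => [ij|_]; last by rewrite scaler0.
  by rewrite -bj -ij bi eqxx in wv.
have [s us sP] := dual_supp x.
exists (map b s), (fun v => \sum_(i <- s | b i == v) k i x); split.
  by move=> _ /= /mapP[i _ ->]; exists i.
rewrite big_map [LHS](dual_expand us sP) big_seq [RHS]big_seq.
apply: eq_bigr => i si; congr (_ *: _).
rewrite (eq_bigl (pred1 i)) => [|j]; last by rewrite (inj_eq bI).
by rewrite -big_filter filter_pred1_uniq // big_seq1.
Qed.

Lemma dual_ext (N : lmodType R) (f : I -> N) :
  exists phi : {linear M -> N}, forall i, phi (b i) = f i.
Proof.
have [kb fin sep] := bk.
have /choice[s sP] : forall x, exists s, uniq s /\ forall i, k i x != 0 -> i \in s.
  by move=> x; have [s] := dual_supp x; exists s.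
pose phi x := \sum_(i <- s x) (k i x : R) *: f i.
have phiE x t : uniq t -> (forall i, k i x != 0 -> i \in t) ->
    phi x = \sum_(i <- t) (k i x : R) *: f i.
  have aux u : uniq u -> {subset s x <= u} ->
      phi x = \sum_(i <- u) (k i x : R) *: f i.
    move=> uu su; have [us sxP] := sP x.
    rewrite [RHS](bigID [in s x]) /= [X in _ + X]big1 ?addr0 => [|i ns].
      rewrite -big_filter; apply: perm_big; apply: uniq_perm => //.
        exact: filter_uniq.
      move=> i; rewrite mem_filter.
      by case: (boolP (i \in s x)) => // /su ->.
    have [->|/sxP] := eqVneq (k i x) 0; first by rewrite scale0r.
    by rewrite (negPf ns).
  move=> ut tP; rewrite (aux (undup (s x ++ t))) ?undup_uniq //.
    rewrite [LHS](bigID [in t]) /= [X in _ + X]big1 ?addr0 => [|i ns].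
      rewrite -big_filter; apply: perm_big; apply: uniq_perm => //.
        by rewrite filter_uniq ?undup_uniq.
      move=> i; rewrite mem_filter mem_undup mem_cat.
      by case: (i \in t); rewrite ?orbT.
    have [->|/tP] := eqVneq (k i x) 0; first by rewrite scale0r.
    by rewrite (negPf ns).
  by move=> i; rewrite mem_undup mem_cat => ->.
have phi_lin : linear phi.
  move=> a x y; have [us sx] := sP x; have [us' sy] := sP y.
  pose t := undup (s x ++ s y).
  have ut : uniq t by apply: undup_uniq.
  have inx i : i \in s x -> i \in t by rewrite mem_undup mem_cat => ->.
  have iny i : i \in s y -> i \in t by rewrite mem_undup mem_cat orbC => ->.
  rewrite (@phiE x t) // => [|i /sx/inx //].
  rewrite (@phiE y t) // => [|i /sy/iny //].
  rewrite (@phiE _ t) //.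
    rewrite scaler_sumr -big_split /=; apply: eq_bigr => i _.
    by rewrite linearP scalerDl -scalerA.
  move=> i; have [kx|/sx/inx //] := eqVneq (k i x) 0.
  have [ky|/sy/iny //] := eqVneq (k i y) 0.
  by rewrite linearP kx ky scaler0 addr0 eqxx.
pose phi' : {linear M -> N} :=
  HB.pack phi (GRing.isLinear.Build R M N _ phi phi_lin).
exists phi' => i; rewrite -[LHS]/(phi (b i)).
rewrite (@phiE _ [:: i]) // => [|j].
  by rewrite big_seq1 kb eqxx scale1r.
by rewrite kb inE; case: (j == i); rewrite // mulr0n eqxx.
Qed.

Lemma dual_eq (N : lmodType R) (f g : {linear M -> N}) :
  (forall i, f (b i) = g (b i)) -> f =1 g.
Proof.
move=> fg x; have [s us sP] := dual_supp x.
rewrite (dual_expand us sP) !raddf_sum; apply: eq_bigr => i _.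
by rewrite /= !linearZ /= fg.
Qed.

End DualBasis.

(** * Linear maps, subspaces and quotients *)

Lemma has_dim_dual (R : nzRingType) (M : lmodType R) (r : Type) :
  has_dim M r ->
  exists (b : {classic r} -> M) (k : {classic r} -> {linear M -> R^o}),
    dual_basis b k.
Proof. exact: (@dual_of_has_dim R M {classic r}). Qed.

Lemma has_dim_isom (R : nzRingType) (M N : lmodType R) (r : Type) :
  has_dim M r -> has_dim N r ->
  exists (f : {linear M -> N}) (g : {linear N -> M}), cancel f g /\ cancel g f.
Proof.
move=> /has_dim_dual[b [k bk]] /has_dim_dual[b' [k' bk']].
have [f fE] := dual_ext bk b'; have [g gE] := dual_ext bk' b.
exists f, g; split=> x.
  by apply: (dual_eq (f := g \o f) (g := idfun) bk) => i /=; rewrite fE gE.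
by apply: (dual_eq (f := f \o g) (g := idfun) bk') => i /=; rewrite gE fE.
Qed.

Lemma proj_linear (R : pzRingType) (M : lmodType R) (U : submodule M) :
  linear (proj U).
Proof. by move=> a x y; rewrite raddfD /= -quot_scaleE. Qed.

HB.instance Definition _ (R : pzRingType) (M : lmodType R)
    (U : submodule M) :=
  GRing.isLinear.Build R M (quot U) _ (proj U) (@proj_linear R M U).

Lemma sub_val_linear (R : pzRingType) (M : lmodType R) (U : submodule M) :
  linear (@sub_val M U).
Proof. by move=> a x y. Qed.

HB.instance Definition _ (R : pzRingType) (M : lmodType R)
    (U : submodule M) :=
  GRing.isLinear.Build R (sub_of U) M _ (@sub_val M U) (@sub_val_linear R M U).

Lemma proj_eq0 (M : zmodType) (U : zmodClosed M) x :
  (proj U x == 0) = (x \in U).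
Proof.
apply/eqP/idP => [x0|xU]; last first.
  by rewrite -(raddf0 (proj U)); apply/proj_eqP; rewrite subr0.
by rewrite -[x]subr0; apply/proj_eqP; rewrite raddf0.
Qed.

Lemma proj_sub (M : zmodType) (U : zmodClosed M) (u : sub_of U) :
  proj U (sub_val u) = 0.
Proof. by apply/eqP; rewrite proj_eq0; apply: (sub_valP u). Qed.

Lemma quot_section (R : nzRingType) (M : lmodType R) (U : submodule M)
    (r : Type) :
  has_dim (quot U) r -> exists s : {linear quot U -> M}, cancel s (proj U).
Proof.
move=> /has_dim_dual[b [k bk]].
have [s sE] := dual_ext bk (fun i => quot_repr (b i)).
exists s; apply: (dual_eq (f := proj U \o s) (g := idfun) bk) => i /=.
by rewrite sE quot_reprK.
Qed.

(** A section [t] of the quotient map identifies the module with the direct sum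
of [U] and its quotient; [e] is the projection onto [U] along the image of [t]. *)
Lemma submodule_split (R : nzRingType) (M : lmodType R) (U : submodule M)
    (t : {linear quot U -> M}) :
  cancel t (proj U) ->
  exists2 e : {linear M -> sub_of U},
    forall w, w = sub_val (e w) + t (proj U w)
    & forall u x, e (sub_val u + t x) = u.
Proof.
move=> tK; have eP w : w - t (proj U w) \in U by apply/proj_eqP; rewrite tK.
pose e w : sub_of U := SubOf (eP w).
have e_lin : linear e.
  move=> a x y; apply: val_inj.
  rewrite [RHS](linearP (@sub_val M U)) /= (linearP (proj U)) /= (linearP t) /=.
  by rewrite opprD scalerBr addrACA.
exists (HB.pack_for {linear M -> sub_of U} e
          (GRing.isLinear.Build R M _ _ e e_lin)) => [w|u x].
  by rewrite /= subrK.
by apply: val_inj; rewrite /= raddfD /= tK proj_sub add0r addrK.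
Qed.

(** * The group GL(V) and its action *)

Section LinearGroup.
Variables (F : pzRingType) (V : lmodType F).

Definition gl_comp (g h : GL V) : GL V :=
  MkGL (gl_fun := h \o g) (bij_comp (gl_bij h) (gl_bij g)).

Lemma gl_inverse (g : GL V) : exists h : GL V, cancel g h /\ cancel h g.
Proof.
have [f gK fK] := gl_bij g.
pose f' : {linear V -> V} :=
  HB.pack f (GRing.isLinear.Build F V V _ f (can2_linear gK fK)).
by exists (@MkGL _ _ f' (Bijective fK gK)).
Qed.

Variables r r' : Type.
Implicit Types (L : Gr r r' V) (g h : GL V).

Lemma mem_gr_act L g v : (g v \in gr_space (gr_act L g)) = (v \in gr_space L).
Proof. exact: mem_gl_space. Qed.

Lemma gr_act_mem L g w : w \in gr_space (gr_act L g) ->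
  exists2 v, v \in gr_space L & w = g v.
Proof. by move=> /gl_imageP[v vL <-]; exists v. Qed.

Lemma eq_gr_act L g h : {in gr_space L, g =1 h} -> gr_act L g = gr_act L h.
Proof.
move=> gh; apply: gr_eqP => w; apply/idP/idP => /gr_act_mem[v vL ->].
  by rewrite gh // mem_gr_act.
by rewrite -gh // mem_gr_act.
Qed.

Lemma gr_act_id L g : {in gr_space L, g =1 id} -> gr_act L g = L.
Proof.
move=> gid; apply: gr_eqP => w; apply/idP/idP => [/gr_act_mem[v vL ->]|wL].
  by rewrite gid.
by have := mem_gr_act L g w; rewrite gid // wL.
Qed.

Lemma gr_act_comp L g h : gr_act (gr_act L g) h = gr_act L (gl_comp g h).
Proof.
apply: gr_eqP => w; apply/idP/idP.
  move=> /gr_act_mem[_ /gr_act_mem[v vL ->] ->].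
  by rewrite (mem_gr_act L (gl_comp g h)).
move=> /gr_act_mem[v vL ->].
by rewrite -[gl_comp g h v]/(h (g v)) !mem_gr_act.
Qed.

Lemma gr_actK L g h : cancel g h -> gr_act (gr_act L g) h = L.
Proof. by move=> gK; rewrite gr_act_comp; apply: gr_act_id => v _ /=. Qed.

Lemma gr_act_eqP L L' g :
  (forall v, (g v \in gr_space L') = (v \in gr_space L)) -> gr_act L g = L'.
Proof.
move=> gL; apply: gr_eqP => w; have [f _ fK] := gl_bij g.
by rewrite -[w]fK mem_gr_act gL.
Qed.

End LinearGroup.

Section Transitivity.
Variables (F : unitRingType) (V : lmodType F) (r r' : Type).

(** Subspaces of equal dimension and codimension are matched by an isomorphism
between them and one between the quotients, glued along the splittings of V. *)
Lemma gl_transitive (L L' : Gr r r' V) : exists h : GL V, gr_act L h = L'.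
Proof.
have [f [f' [fK f'K]]] := has_dim_isom (gr_dim L) (gr_dim L').
have [q [q' [qK q'K]]] := has_dim_isom (gr_codim L) (gr_codim L').
have [s sK] := quot_section (gr_codim L).
have [s' s'K] := quot_section (gr_codim L').
have [e eE eK] := submodule_split sK; have [e' e'E e'K] := submodule_split s'K.
pose h w := sub_val (f (e w)) + s' (q (proj _ w)).
pose h' w := sub_val (f' (e' w)) + s (q' (proj _ w)).
have h_lin : linear h.
  by move=> a x y; rewrite /h !linearP scalerDr addrACA.
have projE (U : submodule V) (t : {linear quot U -> V}) (u : sub_of U) x :
    cancel t (proj U) -> proj U (sub_val u + t x) = x.
  move=> tK; rewrite raddfD /= tK.
  by rewrite proj_sub add0r.
have hK : cancel h h' by move=> w; rewrite /h /h' e'K projE // fK qK -eE.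
have h'K : cancel h' h by move=> w; rewrite /h /h' eK projE // f'K q'K -e'E.
pose hl : {linear V -> V} := HB.pack h (GRing.isLinear.Build F V V _ h h_lin).
exists (@MkGL _ _ hl (Bijective hK h'K)); apply: gr_act_eqP => v /=.
rewrite -!proj_eq0 projE // -[in LHS](raddf0 q); apply/eqP/eqP => [|-> //].
by apply: can_inj qK _ _.
Qed.

End Transitivity.

(** * Functionals and reflections *)

Section Reflections.
Variables (F : unitRingType) (V : lmodType F).
Hypothesis F_div : forall x : F, x != 0 -> x \is a GRing.unit.

Definition is_reflection (t : GL V) : Prop :=
  exists (th : {linear V -> F^o}) (u : V), forall w, t w = w + (th w : F) *: u.

Lemma functional_scaler (th : {linear V -> F^o}) (c : F) :
  exists th' : {linear V -> F^o}, forall w, th' w = (th w : F) * c.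
Proof.
pose f w : F^o := (th w : F) * c.
have f_lin : linear f.
  by move=> a x y; rewrite /f linearP mulrDl -mulrA.
by exists (HB.pack_for {linear V -> F^o} f
  (GRing.isLinear.Build F V F^o _ f f_lin)).
Qed.

Lemma functional_normalize (th : {linear V -> F^o}) (x : V) : th x != 0 ->
  exists th' : {linear V -> F^o},
    th' x = 1 /\ forall w, th w = 0 -> th' w = 0.
Proof.
move=> thx; have [f fE] := functional_scaler th (th x : F)^-1.
exists f; split=> [|w w0]; first by rewrite fE mulrV ?F_div.
by rewrite fE w0 mul0r.
Qed.

(** One of [th1], a right multiple of [th2] and [th1 + th2] always works.  This
provides the functional of a reflection that moves [x1] to [x2]: the condition
[th x2 != 0] is its invertibility. *)
Lemma functional_pair (th1 th2 : {linear V -> F^o}) (x1 x2 : V) :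
  th1 x1 = 1 -> th2 x2 = 1 ->
  exists th : {linear V -> F^o},
    [/\ th x1 = 1, th x2 != 0 & forall w, th1 w = 0 -> th2 w = 0 -> th w = 0].
Proof.
move=> e1 e2.
have [t12|t12] := eqVneq (th1 x2) 0; last first.
  by exists th1; split=> // w.
have [t21|t21] := eqVneq (th2 x1) 0; last first.
  have [f [f1 f0]] := functional_normalize t21.
  have [g gE] := functional_scaler th2 (th2 x1 : F)^-1.
  exists g; split=> [||w _ w0]; rewrite gE; first by rewrite mulrV ?F_div.
    rewrite e2 mul1r; apply/eqP => i0.
    by move: (F_div t21); rewrite -unitrV i0 unitr0.
  by rewrite w0 mul0r.
exists (th1 \+ th2); split=> [||w w1 w2] /=; first by rewrite e1 t21 addr0.
  by rewrite t12 e2 add0r oner_eq0.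
by rewrite w1 w2 addr0.
Qed.

(** The dual statement, which provides the vector of a reflection that moves one
functional to another. *)
Lemma vector_pair (th1 th2 : {linear V -> F^o}) (x1 x2 : V) :
  th1 x1 = 1 -> th2 x2 = 1 ->
  exists x : V, [/\ th1 x = 1, th2 x != 0
    & forall th : {linear V -> F^o}, th x1 = 0 -> th x2 = 0 -> th x = 0].
Proof.
move=> e1 e2.
have [t21|t21] := eqVneq (th2 x1) 0; last by exists x1; split.
have [t12|t12] := eqVneq (th1 x2) 0; last first.
  exists ((th1 x2 : F)^-1 *: x2); split=> [||th _ x0]; rewrite linearZ /=.
  - by rewrite /GRing.scale /= mulVr ?F_div.
  - rewrite e2 /GRing.scale /= mulr1; apply/eqP => i0.
    by move: (F_div t12); rewrite -unitrV i0 unitr0.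
  - by rewrite x0 scaler0.
exists (x1 + x2); split=> [||th y1 y2]; rewrite raddfD /=.
- by rewrite e1 t12 addr0.
- by rewrite t21 e2 add0r oner_eq0.
- by rewrite y1 y2 addr0.
Qed.

Lemma reflection_exists (th : {linear V -> F^o}) (u : V) : 1 + (th u : F) != 0 ->
  exists t : GL V, forall w, t w = w + (th w : F) *: u.
Proof.
move=> /F_div thu; pose c := (1 + (th u : F))^-1.
pose f w := w + (th w : F) *: u.
pose g w := w - ((th w : F) * c) *: u.
have f_lin : linear f.
  by move=> a x y; rewrite /f linearP scalerDl scalerDr scalerA addrACA.
have thE w d : (th (w + d *: u) : F) = (th w : F) + d * (th u : F).
  by rewrite linearD linearZ.
have fK : cancel f g.
  move=> w; rewrite /g thE /f -[X in (X + _) * c]mulr1 -mulrDr -mulrA mulrV //.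
  by rewrite mulr1 addrK.
have gK : cancel g f.
  move=> w; rewrite /g -scaleNr /f thE -addrA -scalerDl mulNr addrCA -opprD.
  have -> : (th w : F) * c + (th w : F) * c * (th u : F) = th w.
    by rewrite -[X in X + _]mulr1 -mulrDr -mulrA mulVr // mulr1.
  by rewrite subrr scale0r addr0.
pose fl : {linear V -> V} := HB.pack f (GRing.isLinear.Build F V V _ f f_lin).
by exists (@MkGL _ _ fl (Bijective fK gK)).
Qed.

Lemma functional_of_nonzero (s : Type) (v : V) : has_dim V s -> v != 0 ->
  exists th : {linear V -> F^o}, th v = 1.
Proof.
move=> /(@has_dim_dual F V)[b [k [_ _ sep]]] v0.
have [i ki] : exists i, k i v != 0.
  apply: contrapT => nk; move/eqP: v0; apply; apply: sep => i.
  by apply/eqP; apply: contra_notT nk => ki; exists i.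
by have [th [th1 _]] := functional_normalize ki; exists th.
Qed.

Section Grassmannian.
Variables r r' : Type.
Implicit Types L : Gr r r' V.

(** The functional is pulled back from a coordinate on the quotient by [L]. *)
Lemma gr_functional L v : v \notin gr_space L ->
  exists th : {linear V -> F^o}, th v = 1 /\ {in gr_space L, forall w, th w = 0}.
Proof.
move=> vL; have [b [k [_ _ sep]]] := has_dim_dual (gr_codim L).
have [i ki] : exists i, k i (proj (gr_space L) v) != 0.
  apply: contrapT => nk; move: vL; rewrite -proj_eq0 => /eqP; apply; apply: sep => i.
  by apply/eqP; apply: contra_notT nk => ki; exists i.
have [th [th1 th0]] := @functional_normalize (k i \o proj (gr_space L)) v ki.
exists th; split=> // w wL; apply: th0 => /=.
by move: wL; rewrite -proj_eq0 => /eqP ->; rewrite raddf0.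
Qed.

(** The reflection [w |-> w + th(w) (v' - v)] moves vectors by elements of [L]
only, so it stabilizes [L]. *)
Lemma stabilizer_transitive (s : Type) L (v v' : V) :
  has_dim V s -> v != 0 -> v' != 0 -> v \in gr_space L -> v' \in gr_space L ->
  exists h : GL V, gr_act L h = L /\ h v = v'.
Proof.
move=> dimV v0 v'0 vL v'L.
have [th1 e1] := functional_of_nonzero dimV v0.
have [th2 e2] := functional_of_nonzero dimV v'0.
have [th [thv thv' _]] := functional_pair e1 e2.
have [|h hE] := @reflection_exists th (v' - v).
  by rewrite raddfB /= thv addrC subrK.
exists h; split; last by rewrite hE thv scale1r addrC subrK.
apply: gr_act_eqP => w; rewrite hE.
by rewrite rpredDr // rpredZ // rpredB.
Qed.

End Grassmannian.
End Reflections.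

(** * Linked subspaces *)

Section Linked.
Variables (F : unitRingType) (V : lmodType F) (r r' : Type).
Hypothesis F_div : forall x : F, x != 0 -> x \is a GRing.unit.
Implicit Types L : Gr r r' V.

Definition linked : Gr r r' V -> Gr r r' V -> Prop :=
  clos_refl_sym_trans _
    (fun L L' => exists2 t : GL V, is_reflection t & gr_act L t = L').

(** The conjugate of a reflection is a reflection. *)
Lemma linked_act L L' (g : GL V) :
  linked L L' -> linked (gr_act L g) (gr_act L' g).
Proof.
have [h [gK hK]] := gl_inverse g.
elim=> [{}L _ [t [th [u tE]] <-]|{}L|{}L {}L' _|{}L {}L' L'' _ LL' _].
- pose th' : {linear V -> F^o} := th \o h.
  apply: rst_step; exists (gl_comp (gl_comp h t) g).
    by exists th', (g u) => w /=; rewrite tE raddfD /= hK linearZ.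
  by rewrite !gr_act_comp; apply: eq_gr_act => v _ /=; rewrite gK.
- exact: rst_refl.
- exact: rst_sym.
- exact: rst_trans.
Qed.

(** Let [g] carry [L] to [L'] and fix some of the vectors of a basis of [L'].  A
reflection that fixes these vectors and sends the preimage [z] of the next basis
vector [c i] to [c i] replaces [L] and [g] by a pair that fixes one more vector;
once the whole basis is fixed, [g] is the identity on [L'], so [L = L']. *)
Lemma linked_finite_dim L L' : finite_set [set: r] -> linked L L'.
Proof.
move=> /(@finite_seqP {classic r})[s rs].
have sP i : i \in s by have : [set: r] i by []; rewrite rs.
have [b [k bk]] := has_dim_dual (gr_dim L').
have [t tK] := quot_section (gr_codim L').
have [e eE eK] := submodule_split tK.
pose c i := sub_val (b i).
pose psi i : {linear V -> F^o} := k i \o e.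
have psic i j : psi i (c j) = (i == j)%:R.
  have [<- _ _] := bk; rewrite /psi /c /=; congr (k i _).
  by rewrite -[sub_val _]addr0 -(raddf0 t) eK.
have [g gL] := gl_transitive L L'.
(* s lists the basis vectors that g is still allowed to move *)
have : forall i, i \notin s -> g (c i) = c i by move=> i; rewrite sP.
elim: s g L gL {rs sP} => [|i s IHs] g L gL gc.
  have gid : {in gr_space L', g =1 id}.
    move=> w wL'; have := dual_eq (f := g \o @sub_val V _) (g := @sub_val V _) bk.
    by move=> /(_ (fun i => gc i isT) (SubOf wL')).
  have [h [gK hK]] := gl_inverse g.
  rewrite -(gr_actK L gK) gL -[X in gr_act X h](gr_act_id gid) (gr_actK _ gK).
  exact: rst_refl.
have [h [gK hK]] := gl_inverse g.
have e1 : (psi i \o g) (h (c i)) = 1.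
  by rewrite -[LHS]/(psi i (g (h (c i)))) hK psic eqxx.
have e2 : psi i (c i) = 1 by rewrite psic eqxx.
have [th [thz thc th0]] := functional_pair F_div e1 e2.
have [|tau tauE] := @reflection_exists _ _ F_div th (c i - h (c i)).
  by rewrite raddfB /= thz addrC subrK.
have tau_z : tau (h (c i)) = c i by rewrite tauE thz scale1r addrC subrK.
have [tau' [tauK tau'K]] := gl_inverse tau.
apply: (@rst_trans _ _ _ (gr_act L tau)).
  by apply: rst_step; exists tau => //; exists th, (c i - h (c i)).
apply: (IHs (gl_comp tau' g)) => [|j js] /=.
  rewrite gr_act_comp -gL; apply: eq_gr_act => v _ /=; by rewrite tauK.
have [->|ji] := eqVneq j i; first by rewrite -[X in tau' X]tau_z tauK hK.
have gcj : g (c j) = c j by apply: gc; rewrite inE negb_or ji.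
have psij : psi i (c j) = 0 by rewrite psic eq_sym (negPf ji).
have tau_c : tau (c j) = c j.
  by rewrite tauE th0 ?scale0r ?addr0 // -[LHS]/(psi i (g (c j))) gcj.
by rewrite -[X in tau' X]tau_c tauK.
Qed.

(** The dual argument, with the functionals [psi i] that cut out [L'] in place of
a basis of [L']: each reflection makes [g] preserve one more of them. *)
Lemma linked_finite_codim L L' : finite_set [set: r'] -> linked L L'.
Proof.
move=> /(@finite_seqP {classic r'})[s rs].
have sP i : i \in s by have : [set: r'] i by []; rewrite rs.
have [b [k bk]] := has_dim_dual (gr_codim L').
pose c i := quot_repr (b i).
pose psi i : {linear V -> F^o} := k i \o proj (gr_space L').
have psic i j : psi i (c j) = (i == j)%:R.
  by have [<- _ _] := bk; rewrite /psi /c /= quot_reprK.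
have psiL w : (forall i, psi i w = 0) <-> w \in gr_space L'.
  rewrite -proj_eq0; split=> [w0|/eqP w0 i]; last by rewrite /psi /= w0 raddf0.
  by have [_ _ sep] := bk; apply/eqP; apply: sep.
have [g gL] := gl_transitive L L'.
(* s lists the functionals that g need not preserve yet *)
have : forall i, i \notin s -> forall w, psi i (g w) = psi i w.
  by move=> i; rewrite sP.
elim: s g L gL {rs sP} => [|i s IHs] g L gL gpsi.
  suff -> : L = L' by apply: rst_refl.
  apply: gr_eqP => w; rewrite -(mem_gr_act L g) gL.
  by apply/idP/idP => /psiL w0; apply/psiL => i; [rewrite -gpsi | rewrite gpsi].
have [h [gK hK]] := gl_inverse g.
have e1 : psi i (c i) = 1 by rewrite psic eqxx.
have e2 : (psi i \o g) (h (c i)) = 1.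
  by rewrite -[LHS]/(psi i (g (h (c i)))) hK psic eqxx.
have [u [psiu psigu u0]] := vector_pair F_div e1 e2.
pose th : {linear V -> F^o} := (psi i \o g) \- psi i.
have [|tau tauE] := @reflection_exists _ _ F_div th u.
  by rewrite -[th u]/(psi i (g u) - psi i u) psiu addrC subrK.
have [tau' [tauK tau'K]] := gl_inverse tau.
apply: (@rst_trans _ _ _ (gr_act L tau)).
  by apply: rst_step; exists tau => //; exists th, u.
apply: (IHs (gl_comp tau' g)) => [|j js w].
  by rewrite gr_act_comp -gL; apply: eq_gr_act => v _ /=; rewrite tauK.
rewrite -[gl_comp tau' g w]/(g (tau' w)) -[in RHS](tau'K w).
move: (tau' w) => {}w; rewrite tauE linearD linearZ.
have [->|ji] := eqVneq j i.
  rewrite psiu -[RHS]/(psi i w + ((psi i (g w) : F) - psi i w) * 1).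
  by rewrite mulr1 addrC subrK.
have jis : j \notin i :: s by rewrite inE negb_or ji.
have psij : psi j (c i) = 0 by rewrite psic (negPf ji).
have -> : psi j u = 0 by apply: u0; rewrite // -(gpsi _ jis) hK.
by rewrite gpsi // raddf0 addr0.
Qed.

End Linked.

(** * Existence of subspaces, and of unlinked ones *)

Section Existence.
Variables (F : unitRingType) (V : lmodType F) (r r' : Type).
Hypothesis F_div : forall x : F, x != 0 -> x \is a GRing.unit.

(** The span of the [b (inl i)], described as the common kernel of the other
coordinates. *)
Lemma gr_of_dual_basis (b : {classic r} + {classic r'} -> V)
    (k : {classic r} + {classic r'} -> {linear V -> F^o}) :
  dual_basis b k ->
  exists L : Gr r r' V,
    forall x, (x \in gr_space L) <-> (forall j, k (inr j) x = 0).
Proof.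
move=> bk; have [kb _ sep] := bk.
pose P : {pred V} := [pred x | `[< forall j, k (inr j) x = 0 >]].
have PE x : reflect (forall j, k (inr j) x = 0) (x \in P) by apply: asboolP.
have P_closed : GRing.submod_closed P.
  split; first by apply/PE => j; rewrite raddf0.
  move=> a x y /PE x0 /PE y0; apply/PE => j.
  by rewrite linearP x0 y0 addr0 scaler0.
pose U := Submodule P_closed.
have dimU : has_dim (sub_of U) {classic r}.
  have bU i : b (inl i) \in U by apply/PE => j; rewrite kb.
  apply: (@has_dim_of_dual _ (sub_of U) {classic r}
    (fun i => @SubOf _ U _ (bU i)) (fun i => k (inl i) \o @sub_val _ U)).
  split=> [i j|x|x x0] /=; first by rewrite kb.
    have [s _ sP] := dual_supp bk (sub_val x).
    exists (pmap (fun i => if i is inl i then Some i else None) s) => i /sP si.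
    by rewrite mem_pmap; apply/mapP; exists (inl i).
  apply: val_inj; apply: sep => -[i|j]; first exact: x0.
  by have /PE := sub_valP x; apply.
have codimU : has_dim (quot U) {classic r'}.
  pose q j (x : quot U) : F^o := k (inr j) (quot_repr x).
  have qE j x : q j (proj U x) = k (inr j) x.
    apply/eqP; rewrite -subr_eq0 -raddfB; apply/eqP.
    have : quot_repr (proj U x) - x \in U by apply/proj_eqP; rewrite quot_reprK.
    by move/PE; apply.
  have q_lin j : linear (q j).
    move=> a x y; rewrite -[x]quot_reprK -[y]quot_reprK -linearP !qE.
    exact: linearP.
  pose k' j : {linear quot U -> F^o} :=
    HB.pack (q j) (GRing.isLinear.Build F (quot U) F^o _ (q j) (q_lin j)).
  apply: (@has_dim_of_dual _ (quot U) {classic r'}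
    (fun j => proj U (b (inr j))) k').
  split=> [i j|x|x x0].
  - by rewrite -[LHS]/(q i _) qE kb.
  - have [s _ sP] := dual_supp bk (quot_repr x).
    exists (pmap (fun i => if i is inr i then Some i else None) s) => i /sP si.
    by rewrite mem_pmap; apply/mapP; exists (inr i).
  - apply/eqP; rewrite -[x]quot_reprK proj_eq0; apply/PE => j; exact: x0.
by exists (MkGr dimU codimU) => x; split => [/PE|xP]; last apply/PE.
Qed.

Hypothesis dimV : has_dim V (r + r')%type.

Lemma has_dim_sum_dual :
  exists (b : {classic r} + {classic r'} -> V)
    (k : {classic r} + {classic r'} -> {linear V -> F^o}), dual_basis b k.
Proof. exact: (@dual_of_has_dim F V ({classic r} + {classic r'})%type). Qed.

Lemma gr_inhabited : inhabited (Gr r r' V).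
Proof.
have [b [k bk]] := has_dim_sum_dual.
by have [L _] := gr_of_dual_basis bk.
Qed.

Lemma gr_nonzero (L : Gr r r' V) : inhabited r ->
  exists2 v, v \in gr_space L & v != 0.
Proof.
move=> [i]; have [b [k [kb _ _]]] := has_dim_dual (gr_dim L).
exists (sub_val (b i)); first exact: (sub_valP (b i)).
apply/eqP => b0; have := kb i i; rewrite eqxx.
have -> : b i = 0 by apply: val_inj.
by rewrite raddf0 => /esym/eqP; rewrite oner_eq0.
Qed.

Lemma gr_proper (L : Gr r r' V) : inhabited r' -> exists v, v \notin gr_space L.
Proof.
move=> [j]; have [b [k [kb _ _]]] := has_dim_dual (gr_codim L).
exists (quot_repr (b j)); rewrite -proj_eq0 quot_reprK.
apply/eqP => b0; have := kb j j; rewrite eqxx b0.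
by rewrite raddf0 => /esym/eqP; rewrite oner_eq0.
Qed.

(** For [v] in [L] and [u] outside, a transvection takes [v] out of [L]; the
vector [u] is first corrected by a multiple of [v] so that [th] vanishes on it. *)
Lemma reflection_moves (L : Gr r r' V) : inhabited r -> inhabited r' ->
  exists2 t : GL V, is_reflection t & gr_act L t != L.
Proof.
move=> r_gt0 r'_gt0; have [v vL v0] := gr_nonzero L r_gt0.
have [u uL] := gr_proper L r'_gt0.
have [th thv] := functional_of_nonzero F_div dimV v0.
pose u' := u - (th u : F) *: v.
have thu' : th u' = 0.
  by rewrite raddfB /= linearZ /= thv /GRing.scale /= mulr1 subrr.
have [|t tE] := @reflection_exists _ _ F_div th u'.
  by rewrite thu' addr0 oner_neq0.
exists t; first by exists th, u'.
apply: contra uL => /eqP tL; have := mem_gr_act L t v.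
rewrite tL vL tE thv scale1r => uvL.
have -> : u = v + u' - v + (th u : F) *: v by rewrite [v + _]addrC addrK subrK.
by rewrite rpredD ?rpredZ // rpredB.
Qed.

(** [L'] is contained in the sum of [L] and a finitely generated subspace, in
terms of the functionals that vanish on this sum. *)
Definition almost_contains (L L' : Gr r r' V) : Prop :=
  exists us : seq V, forall f : {linear V -> F^o},
    {in gr_space L, forall w, f w = 0} -> {in us, forall u, f u = 0} ->
    {in gr_space L', forall w, f w = 0}.

(** A reflection with vector [u] changes vectors by multiples of [u] only.  Both
directions are proved together because [linked] is symmetric. *)
Lemma linked_almost_contains (L L' : Gr r r' V) : linked L L' ->
  almost_contains L L' /\ almost_contains L' L.
Proof.
elim=> [{}L _ [t [th [u tE]] <-]|{}L|{}L {}L' _ []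
       |{}L {}L' L'' _ [IH1 IH1'] _ [IH2 IH2']] //.
- split; exists [:: u] => f fL fu w.
    move=> /gr_act_mem[v vL ->].
    by rewrite tE linearD linearZ /= fL // (fu u) ?inE // scaler0 addr0.
  move=> wL; have := fL (t w); rewrite mem_gr_act => /(_ wL).
  by rewrite tE linearD linearZ /= (fu u) ?inE // scaler0 addr0.
- by split; exists [::].
- have trans (A B C : Gr r r' V) :
      almost_contains A B -> almost_contains B C -> almost_contains A C.
    move=> [s1 P1] [s2 P2]; exists (s1 ++ s2) => f fA fs.
    apply: P2 => [|u us]; last by apply: fs; rewrite mem_cat us orbT.
    by apply: P1 => // u us; apply: fs; rewrite mem_cat us.
  by split; [apply: trans IH1 IH2 | apply: trans IH2' IH1'].
Qed.

(** Let [L] be spanned by the [b (inl i)], and let the automorphism [1 + nu] send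
[b (inl i)] to [b (inl i) + b (inr (m i))], where [m] takes infinitely many
values.  The image of [L] involves infinitely many of the coordinates
[k (inr j)], all of which vanish on [L], while finitely many vectors involve only
finitely many coordinates. *)
Lemma unlinked_exist : infinite_set [set: r] -> infinite_set [set: r'] ->
  exists L L' : Gr r r' V, ~ linked L L'.
Proof.
move=> rinf r'inf; have [b [k bk]] := has_dim_sum_dual.
have [kb _ _] := bk; have [L LP] := gr_of_dual_basis bk.
have [m mP] : exists m : {classic r} -> {classic r'},
    forall s : seq {classic r'}, exists i, m i \notin s.
  (* m is a surjection from r onto nat followed by an injection into r' *)
  have /infiniteP/(@pcard_surjP nat r [set: nat] [set: r])[e eP] := rinf.
  have /infiniteP/card_leP[f0] := r'inf.
  pose f n : {classic r'} := set_val (f0 (SigSub (mem_set I : n \in [set: nat]))).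
  have fI : injective f.
    by move=> x y /val_inj /(@inj _ _ _ f0); rewrite !inE => /(_ I I) [].
  exists (f \o e) => s; apply: contrapT => nm.
  have fs n : f n \in s.
    have [i _ <-] := eP n I; apply: contra_notT nm => ns; by exists i.
  have /uniq_leq_size : uniq (map f (iota 0 (size s).+1)).
    by rewrite map_inj_uniq ?iota_uniq.
  move=> /(_ s); rewrite size_map size_iota ltnn => sub.
  by suff: false by []; apply: sub => _ /mapP[n _ ->]; apply: fs.
have [nu nuE] := dual_ext bk (fun i => if i is inl i then b (inr (m i)) else 0).
have nu2 w : nu (nu w) = 0.
  have := dual_eq (f := nu \o nu) (g := \0) bk; apply => -[i|j] /=.
    by rewrite !nuE.
  by rewrite nuE raddf0.
pose h : {linear V -> V} := idfun \+ nu.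
have hK : cancel h (idfun \- nu).
  by move=> w /=; rewrite raddfD /= nu2 addr0 addrK.
have h'K : cancel (idfun \- nu) h.
  by move=> w /=; rewrite raddfB /= nu2 subr0 subrK.
pose g : GL V := @MkGL _ _ h (Bijective hK h'K).
exists L, (gr_act L g) => /linked_almost_contains[[us usP] _].
have [s sP] : exists s : seq ({classic r} + {classic r'}), {in us, forall u,
    forall i, k i u != 0 -> i \in s}.
  elim: us {usP} => [|u us [s sP]]; first by exists [::].
  have [s' _ s'P] := dual_supp bk u; exists (s' ++ s) => v; rewrite inE.
  move=> /orP[/eqP -> i /s'P si|/sP vs i /vs si]; by rewrite mem_cat si ?orbT.
have [i ni] := mP (pmap (fun i => if i is inr i then Some i else None) s).
have : k (inr (m i)) (g (b (inl i))) = 0.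
  apply: usP => [w /LP -> //|u uu|]; last first.
    by rewrite mem_gr_act; apply/LP => j; rewrite kb.
  apply/eqP; apply: contraT => /(sP u uu) si.
  by case/negP: ni; rewrite mem_pmap; apply/mapP; exists (inr (m i)).
rewrite -[g _]/(b (inl i) + nu (b (inl i))) nuE (linearD (k (inr (m i)))).
rewrite /= !kb eqxx add0r.
by move/eqP; rewrite oner_eq0.
Qed.

End Existence.

(** * Subset sums and alternating sums over subsets *)

Section SubsetSums.
(* set0 and its theory refer to finite sets here, not to classical sets *)
Import mathcomp.boot.finset.

(** The scalars are chosen one after the other, each outside the finite set of
the opposites of the previous subset sums. *)
Lemma subset_sums_neq0 (F : zmodType) n (F_inf : infinite_set [set: F]) :
  exists mu : 'I_n -> F,
  forall J : {set 'I_n}, J != set0 -> \sum_(i in J) mu i != 0.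
Proof.
suff /(_ n (leqnn n))[mu muP] : forall k, (k <= n)%N -> exists mu : 'I_n -> F,
    forall J : {set 'I_n}, J != set0 -> {in J, forall i : 'I_n, (i < k)%N} ->
    \sum_(i in J) mu i != 0.
  by exists mu => J J0; apply: muP.
elim=> [_|k IHk kn].
  by exists (fun=> 0) => J /set0Pn[i iJ] /(_ i iJ).
have [mu muP] := IHk (ltnW kn); pose k0 := Ordinal kn.
have [x xP] : exists x, x \notin [seq - \sum_(i in J) mu i | J : {set 'I_n}].
  apply: contrapT => nx; apply: F_inf.
  apply: (sub_finite_set _ (finite_seq [seq - \sum_(i in J) mu i | J : {set 'I_n}])).
  by move=> x _ /=; apply: contra_notT nx => xs; exists x.
exists (fun i => if i == k0 then x else mu i) => J J0 Jk.
have same (J' : {set 'I_n}) : k0 \notin J' ->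
    \sum_(i in J') (if i == k0 then x else mu i) = \sum_(i in J') mu i.
  move=> nk; apply: eq_bigr => i iJ; case: eqP => // ik.
  by rewrite -ik iJ in nk.
have [kJ|kJ] := boolP (k0 \in J); last first.
  rewrite same //; apply: muP => // i iJ; rewrite ltn_neqAle -ltnS Jk // andbT.
  by apply: contra kJ => /eqP ik; rewrite -(_ : i = k0) //; apply: val_inj.
rewrite (big_setD1 k0) //= eqxx same ?setD11 // addr_eq0.
apply: contra xP => /eqP ->; apply/mapP; exists (J :\ k0) => //.
by rewrite mem_enum.
Qed.

(** Adding or removing [j] pairs the nonempty subsets with opposite signs, except
for [[set j]], whose partner is the empty set. *)
Lemma alternating_sum_toggle (X : zmodType) (T : finType) (j : T)
    (K : {set T} -> X) :
  (forall J, J != set0 -> j \notin J -> K (j |: J) = K J) ->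
  \sum_(J : {set T} | J != set0) K J *~ (-1) ^+ #|J| = - K [set j].
Proof.
move=> Kj; pose K' J := if J == set0 then K [set j] else K J.
suff : \sum_(J : {set T}) K' J *~ (-1) ^+ #|J| = 0.
  rewrite (bigD1 set0) //= /K' eqxx cards0 expr0 mulr1z.
  by under eq_bigr => J /negPf -> do []; move/eqP; rewrite addrC addr_eq0 => /eqP.
rewrite (bigID (fun J : {set T} => j \in J)) /=.
rewrite (reindex_onto (fun J => j |: J) (fun J => J :\ j)) /=; last first.
  by move=> J jJ; rewrite setD1K.
under eq_bigl => J do rewrite setU11 /=.
rewrite (eq_bigl (fun J : {set T} => j \notin J)) => [|J]; last first.
  apply/eqP/idP => [<-|jJ]; first by rewrite setD11.
  by rewrite setU1K.
rewrite -big_split big1 //= => J jJ.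
rewrite cardsU1 jJ exprS mulN1r mulrNz /K'.
have -> : (j |: J == set0) = false.
  by apply/negbTE/set0Pn; exists j; rewrite setU11.
by case: eqVneq => [->|J0]; rewrite ?setU0 ?Kj // addNr.
Qed.

End SubsetSums.

(** * Extracting differences from a submodule *)

Section FormalCombinations.
(* set0 and its theory refer to finite sets here, not to classical sets *)
Import mathcomp.boot.finset.
Variables (F : unitRingType) (V : lmodType F) (r r' : Type).
Hypothesis F_div : forall x : F, x != 0 -> x \is a GRing.unit.
Hypothesis F_inf : infinite_set [set: F].

Lemma gr_mod_act_additive (A : zmodType) (g : GL V) :
  zmod_morphism (fun x : {malg A[Gr r r' V]} => gr_mod_act x g).
Proof. by apply: malg_ext_is_additive => L a b; rewrite monalgUB. Qed.

Lemma gr_mod_actU (A : zmodType) (g : GL V) (a : A) (L : Gr r r' V) :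
  gr_mod_act << a *g L >> g = << a *g gr_act L g >>.
Proof. by apply: malg_extU; rewrite monalgU0. Qed.

Lemma gr_mod_act_sum (A : zmodType) (g : GL V) n (a : 'I_n -> A)
    (L : 'I_n -> Gr r r' V) :
  gr_mod_act (\sum_(i < n) << a i *g L i >>) g =
  \sum_(i < n) << a i *g gr_act (L i) g >>.
Proof.
pose f : {additive {malg A[Gr r r' V]} -> {malg A[Gr r r' V]}} :=
  HB.pack (fun x => gr_mod_act x g)
    (GRing.isZmodMorphism.Build _ _ (fun x => gr_mod_act x g)
       (gr_mod_act_additive g)).
by rewrite -[LHS]/(f _) raddf_sum; apply: eq_bigr => i _; apply: gr_mod_actU.
Qed.

Section FixedVector.
Variables (A : zmodType) (N : nat) (S : zmodClosed {malg A[Gr r r' V]}).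
Variables (a : 'I_N.+1 -> A) (L : 'I_N.+1 -> Gr r r' V).
Hypothesis S_stable : GL_stable S.
Hypothesis alphaS : \sum_(i < N.+1) << a i *g L i >> \in S.

(** The heart of the proof: up to sign, the alternating sum of the [alpha (g I)]
is [a_0 [L_0]] plus terms that [t] fixes. *)
Lemma extract_reflection (v u : V) (th : {linear V -> F^o}) (t : GL V) :
  v \in gr_space (L ord0) -> (forall i, i != ord0 -> v \notin gr_space (L i)) ->
  th v = 1 -> (forall w, t w = w + (th w : F) *: u) ->
  << a ord0 *g L ord0 >> - << a ord0 *g gr_act (L ord0) t >> \in S.
Proof.
move=> vL0 vL thv tE.
have /choice[y yP] : forall i, exists f : {linear V -> F^o},
    f v = 1 /\ (i != ord0 -> {in gr_space (L i), forall w, f w = 0}).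
  move=> i; have [->|i0] := eqVneq i ord0; first by exists th.
  by have [f [fv fL]] := gr_functional F_div (vL i i0); exists f.
have [mu muP] := subset_sums_neq0 N.+1 F_inf.
have /choice[g gP] : forall I : {set 'I_N.+1}, exists g : GL V, I != set0 ->
    forall w, g w = w + (\sum_(i in I) (y i w : F) * mu i - (th w : F)) *: v.
  move=> I; have [_|I0] := eqVneq I set0.
    by exists (@MkGL _ _ idfun (Bijective (fun=> erefl) (fun=> erefl))).
  pose f w : F^o := \sum_(i in I) (y i w : F) * mu i - (th w : F).
  have f_lin : linear f.
    move=> c w w'; rewrite /f linearP opprD scalerBr addrACA; congr (_ + _).
    rewrite scaler_sumr -big_split; apply: eq_bigr => i _ /=.
    by rewrite linearP mulrDl -mulrA.
  pose fl : {linear V -> F^o} := HB.pack f (GRing.isLinear.Build F V F^o _ f f_lin).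
  have [|h hE] := @reflection_exists _ _ F_div fl v; last by exists h.
  rewrite -[fl v]/(f v) /f thv addrC subrK.
  rewrite (eq_bigr mu) => [|i _]; first exact: muP.
  by rewrite (yP i).1 mul1r.
have g0 (I : {set 'I_N.+1}) : I != set0 -> gr_act (L ord0) (g I) = L ord0.
  move=> I0; apply: gr_act_eqP => w; rewrite gP // rpredDr //; exact: rpredZ.
pose P i := gr_act (L i) (g [set i]).
have P0 : P ord0 = L ord0 by apply: g0; apply/set0Pn; exists ord0; rewrite inE.
(* adding i to I does not change the image of L i under g I *)
have sum_i i : \sum_(I : {set 'I_N.+1} | I != set0)
    << a i *g gr_act (L i) (g I) >> *~ (-1) ^+ #|I| = - << a i *g P i >>.
  apply: (alternating_sum_toggle
            (K := fun I => << a i *g gr_act (L i) (g I) >>)) => I I0 iI.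
  have iI0 : i |: I != set0 by apply/set0Pn; exists i; rewrite setU11.
  congr << _ *g _ >>; have [ie|i0] := eqVneq i ord0.
    by rewrite ie in iI0 *; rewrite !g0.
  apply: eq_gr_act => w wL; rewrite !gP // big_setU1 //=.
  by rewrite (yP i).2 // mul0r add0r.
have betaS : \sum_(i < N.+1) << a i *g P i >> \in S.
  rewrite -[X in X \in _]opprK rpredN -sumrN.
  under eq_bigr do rewrite -sum_i.
  rewrite exchange_big /=; apply: rpred_sum => I I0.
  rewrite -mulrz_suml rpredMz // -gr_mod_act_sum; exact: S_stable.
(* P i lies in the kernel of th, which t fixes pointwise *)
have Pt i : i != ord0 -> gr_act (P i) t = P i.
  move=> i0; apply: gr_act_id => _ /gr_act_mem[w wL ->].
  have -> : g [set i] w = w - (th w : F) *: v.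
    rewrite gP; last by apply/set0Pn; exists i; rewrite inE.
    by rewrite big_set1 (yP i).2 // mul0r add0r scaleNr.
  rewrite tE; have -> : th (w - (th w : F) *: v) = 0.
    by rewrite raddfB /= linearZ /= thv /GRing.scale /= mulr1 subrr.
  by rewrite scale0r addr0.
have := rpredB betaS (S_stable t betaS).
rewrite gr_mod_act_sum !big_ord_recl P0 opprD addrACA.
under [X in _ + (_ - X)]eq_bigr => i _ do rewrite Pt //.
by rewrite subrr addr0.
Qed.

End FixedVector.
End FormalCombinations.

Section Transport.
Variables (F : unitRingType) (V : lmodType F) (r r' : Type).
Hypothesis F_div : forall x : F, x != 0 -> x \is a GRing.unit.
Hypothesis F_inf : infinite_set [set: F].
Variables (A : zmodType) (N : nat) (S : zmodClosed {malg A[Gr r r' V]}).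
Variables (a : 'I_N.+1 -> A) (L : 'I_N.+1 -> Gr r r' V).

(** If [t] moves [L1], its functional does not vanish on [L1]; an automorphism
that carries [L ord0] to [L1], and a vector outside the other subspaces to a
vector [v1] with [th v1 = 1], reduces to the previous lemma. *)
Lemma extract_linked (s : Type) (L1 : Gr r r' V) (t : GL V) :
  has_dim V s -> inhabited r -> GL_stable S ->
  \sum_(i < N.+1) << a i *g L i >> \in S ->
  ~ ([set` gr_space (L ord0)] `<=`
       \bigcup_(i in [set j | j != ord0]) [set` gr_space (L i)]) ->
  is_reflection t ->
  << a ord0 *g L1 >> - << a ord0 *g gr_act L1 t >> \in S.
Proof.
move=> dimV r_gt0 S_stable alphaS L0P [th [u tE]].
have [v [vL0 v0 vL]] : exists v, [/\ v \in gr_space (L ord0), v != 0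
    & forall i, i != ord0 -> v \notin gr_space (L i)].
  have [v vL0 vL] : exists2 v, v \in gr_space (L ord0)
      & forall i, i != ord0 -> v \notin gr_space (L i).
    apply: contrapT => nv; apply: L0P => v vL0; apply: contrapT => vU.
    apply: nv; exists v => // i i0; apply: contra_notN vU => vLi; by exists i.
  (* v = 0 can only happen when L ord0 is the only subspace *)
  have [ve|v0] := eqVneq v 0; last by exists v.
  have [w wL0 w0] := gr_nonzero (L ord0) r_gt0.
  exists w; split=> // i i0; have := vL i i0; by rewrite ve rpred0.
have [thL1|] := pselect (forall w, w \in gr_space L1 -> th w = 0).
  rewrite gr_act_id ?subrr ?rpred0 // => w /thL1.
  by rewrite tE => ->; rewrite scale0r addr0.
move=> /existsNP[w /not_implyP[wL1 /eqP thw]].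
pose v1 := (th w : F)^-1 *: w.
have v1L : v1 \in gr_space L1 by apply: rpredZ.
have thv1 : th v1 = 1 by rewrite linearZ /= /GRing.scale /= mulVr ?F_div.
have v10 : v1 != 0.
  apply/eqP => v10; move: thv1.
  by rewrite v10 raddf0 => /esym/eqP; rewrite oner_eq0.
have [h1 h1L] := gl_transitive (L ord0) L1.
have h1v0 : h1 v != 0.
  by rewrite -(raddf0 h1) (inj_eq (bij_inj (gl_bij h1))).
have h1vL : h1 v \in gr_space L1 by rewrite -h1L mem_gr_act.
have [h2 [h2L h2v]] := stabilizer_transitive F_div dimV h1v0 v10 h1vL v1L.
pose h := gl_comp h1 h2.
have hL : gr_act (L ord0) h = L1 by rewrite -gr_act_comp h1L.
have hv : h v = v1 by [].
have := S_stable h _ alphaS; rewrite gr_mod_act_sum => alphahS.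
rewrite -hL; apply: (extract_reflection F_div F_inf S_stable alphahS
  (v := v1) (u := u) (th := th)) => //; first by rewrite -hv mem_gr_act.
by move=> i i0; rewrite -hv mem_gr_act vL.
Qed.

End Transport.

(** * Additive maps on formal combinations and on tensor products *)

Definition kernel (X Y : zmodType) (f : {additive X -> Y}) : {pred X} :=
  [pred x | f x == 0].

Fact kernel_closed (X Y : zmodType) (f : {additive X -> Y}) :
  zmod_closed (kernel f).
Proof.
split=> [|x y]; rewrite !inE ?raddf0 // => /eqP x0 /eqP y0.
by rewrite raddfB x0 y0 subrr.
Qed.

HB.instance Definition _ (X Y : zmodType) (f : {additive X -> Y}) :=
  GRing.isZmodClosed.Build X (kernel f) (kernel_closed f).

Lemma malg_additive_eq (T : choiceType) (A Y : zmodType)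
    (f g : {additive {malg A[T]} -> Y}) :
  (forall k t, f << k *g t >> = g << k *g t >>) -> f =1 g.
Proof. by move=> fg x; rewrite (monalgE x) !raddf_sum; apply: eq_bigr. Qed.

(** [malg_ext] for a family of bundled additive maps, so that it is itself a
bundled additive map. *)
Definition malg_extA (T : choiceType) (A B : zmodType)
  (f : T -> {additive A -> B}) (x : {malg A[T]}) : B := malg_ext f x.

Lemma malg_extA_additive (T : choiceType) (A B : zmodType)
    (f : T -> {additive A -> B}) : zmod_morphism (malg_extA f).
Proof. by apply: malg_ext_is_additive => t x y; apply: raddfB. Qed.

HB.instance Definition _ (T : choiceType) (A B : zmodType)
    (f : T -> {additive A -> B}) :=
  GRing.isZmodMorphism.Build _ _ (malg_extA f) (malg_extA_additive f).

Lemma malg_extAU (T : choiceType) (A B : zmodType)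
    (f : T -> {additive A -> B}) k t : malg_extA f << k *g t >> = f t k.
Proof. by apply: malg_extU; rewrite raddf0. Qed.

Lemma fgen_inj (T : choiceType) : injective (@fgen T).
Proof.
move=> L L' /(congr1 (mcoeff L)); rewrite /fgen !mcoeffU eqxx.
by case: eqVneq.
Qed.

Section Tensor.
Variables A B : zmodType.

Lemma tensor_lift_mem (C : zmodType) (U : zmodClosed C) (h : A -> B -> C) t :
  biadditive h -> (forall a b, h a b \in U) -> tensor_lift h t \in U.
Proof.
move=> hP hU; rewrite -[t]quot_reprK (tensor_lift_pi hP).
by apply: rpred_sum => ab _; apply: rpredMz; apply: hU.
Qed.

Lemma tensor_map_id (f : B -> B) (t : tensor A B) :
  f =1 id -> tensor_map f t = t.
Proof.
move=> fid; have -> : f = id by apply: funext.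
rewrite -[t]quot_reprK; rewrite /tensor_map (tensor_lift_pi (tens_biadditive A B)).
move: (quot_repr _) => x.
apply: (malg_additive_eq
  (f := malg_extA (fun ab => intmul (tens ab.1 ab.2))) (g := proj _)) => k [a b].
transitivity (tens a b *~ k); first exact: malg_extAU.
rewrite /tens /fgen -raddfMz; congr (proj _ _).
by rewrite -raddfMz intz.
Qed.

End Tensor.

(** * The submodules M_n *)

Section ClassModule.
Variables (F : unitRingType) (V : lmodType F) (r r' : Type).
Notation Grr := (Gr r r' V).
Variable L0 : Grr.

(** A choice of one subspace in each class of linked subspaces; [L0] is a default
value that is never reached, as classes are nonempty. *)
Definition link_repr (L : Grr) : Grr := xget L0 [set L' | linked L L'].

Lemma link_reprP L : linked L (link_repr L).
Proof. by rewrite /link_repr; case: xgetP => // /(_ L) []; apply: rst_refl. Qed.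

Lemma link_repr_eq L L' : linked L L' <-> link_repr L = link_repr L'.
Proof.
split=> [LL'|e].
  congr (xget _ _); apply/seteqP; split=> X /= lX.
    by apply: rst_trans lX; apply: rst_sym.
  exact: rst_trans LL' lX.
apply: rst_trans (link_reprP L) _; rewrite e; apply: rst_sym; exact: link_reprP.
Qed.

(** The projection of Z[Gr] onto Z[Gr/linked], seen inside Z[Gr]. *)
Definition push : {malg int[Grr]} -> {malg int[Grr]} :=
  malg_extA (fun L => mkmalgU (link_repr L)).
HB.instance Definition _ := GRing.Additive.on push.

(** [degree], as a bundled additive map. *)
Definition deg : {malg int[Grr]} -> int := malg_extA (fun=> idfun).
HB.instance Definition _ := GRing.Additive.on deg.

Definition chain (n : nat) : zmodClosed {malg int[Grr]} :=
  if n is 0 then kernel deg else kernel push.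

Lemma pushU k L : push << k *g L >> = << k *g link_repr L >>.
Proof. exact: malg_extAU. Qed.

Lemma degU k L : deg << k *g L >> = k.
Proof. exact: malg_extAU. Qed.

Lemma deg_push x : deg (push x) = deg x.
Proof.
apply: (malg_additive_eq (f := deg \o push) (g := deg)) => k L.
by rewrite /= pushU !degU.
Qed.

(** M_1 is spanned by the differences [[L] - [L t]]: if [push x = 0], then [x] is
the sum of its terms minus their projections. *)
Lemma kernel_push_ind (Y : zmodType) (f : {additive {malg int[Grr]} -> Y})
    (U : zmodClosed Y) :
  (forall k L t, is_reflection t ->
     f << k *g L >> - f << k *g gr_act L t >> \in U) ->
  forall x, x \in kernel push -> f x \in U.
Proof.
move=> fU x; rewrite inE => /eqP px.
have fl k L L' : linked L L' -> f << k *g L >> - f << k *g L' >> \in U.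
  elim=> [{}L _ [t tr <-]|{}L|{}L {}L' _ IH|{}L {}L' L'' _ IH1 _ IH2].
  - exact: fU.
  - by rewrite subrr rpred0.
  - by rewrite -rpredN opprB.
  - by rewrite -[f _](subrK (f << k *g L' >>)) -addrA rpredD.
have -> : f x = f x - f (push x) by rewrite px raddf0 subr0.
rewrite {1}(monalgE x) raddf_sum /push /malg_extA /malg_ext raddf_sum -sumrB.
by apply: rpred_sum => L _; apply/fl/link_reprP.
Qed.

Lemma chain_dec n : {subset chain n.+1 <= chain n}.
Proof.
case: n => [|n] x //; rewrite !inE /= => /eqP px.
by rewrite -deg_push px raddf0.
Qed.

Lemma chain0 : chain 0%N =i degree0 (T := Grr) (A := int).
Proof. by []. Qed.

Lemma chain_stable n : GL_stable (chain n).
Proof.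
move=> g; pose f : {additive _ -> _} :=
  malg_extA (fun L : Grr =>
    mkmalgU (gr_act L g) : {additive int -> {malg int[Grr]}}).
have fU k L : f << k *g L >> = << k *g gr_act L g >> by apply: malg_extAU.
case: n => [|n] x; last first.
  apply: (kernel_push_ind (f := f) (U := kernel push)) => k L t tr.
  rewrite !fU inE raddfB /= !pushU.
  have /link_repr_eq -> : linked (gr_act L g) (gr_act (gr_act L t) g).
    by apply: linked_act; apply: rst_step; exists t.
  by rewrite subrr.
have dfx : deg (f x) = deg x.
  apply: (malg_additive_eq (f := deg \o f) (g := deg)) => k L.
  by rewrite -[LHS]/(deg (f _)) fU /= !degU.
by rewrite !inE => /eqP dx; apply/eqP; apply: etrans dfx dx.
Qed.

Lemma linked_diff_mem L L' : linked L L' ->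
  fgen L - fgen L' \in kernel push.
Proof.
by move=> /link_repr_eq e; rewrite inE raddfB /= !pushU e subrr.
Qed.

Lemma diff_deg0 L L' : fgen L - fgen L' \in chain 0%N.
Proof. by rewrite inE raddfB /= !degU subrr. Qed.

Notation Q := (quot (sub_in (chain 0%N) (chain 1%N))).

Lemma quot_chain_trivial : (forall L L' : Grr, linked L L') ->
  forall x : Q, x = 0.
Proof.
move=> all x; rewrite -[x]quot_reprK; apply/eqP; rewrite proj_eq0 inE.
move: (sub_valP (quot_repr x)); move: (sub_val _) => {}x.
rewrite !inE => /eqP dx.
pose f := (mkmalgU (link_repr L0) : {additive int -> {malg int[Grr]}}) \o deg.
have pf : push x = f x.
  apply: (malg_additive_eq (f := push) (g := f)) => k L.
  by rewrite /f /= pushU degU; congr << _ *g _ >>; apply/link_repr_eq.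
apply/eqP; apply: etrans pf _.
by rewrite /f /= (dx : deg x = 0) raddf0.
Qed.

Lemma quot_chain_nontrivial (L L' : Grr) :
  (forall x : Q, x = 0) -> linked L L'.
Proof.
move=> Q0; have := Q0 (proj _ (SubOf (diff_deg0 L L'))).
move=> /eqP; rewrite proj_eq0 !inE raddfB /= !pushU subr_eq0.
by move=> /eqP/fgen_inj/link_repr_eq.
Qed.

(** The classes of [[R] - [R0]] form a basis, where [R] runs over the
representatives other than [R0]; the coordinate at [R] is the coefficient of [R]
in the projection. *)
Lemma quot_chain_free : free_abelian Q.
Proof.
pose R0 := link_repr L0.
pose P : pred Grr := [pred R | (link_repr R == R) && (R != R0)].
pose I : choiceType := {R : Grr | P R}.
have rr L : link_repr (link_repr L) = link_repr L.
  by apply/esym/link_repr_eq/link_reprP.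
pose b (i : I) : zmodule Q := proj _ (SubOf (diff_deg0 (val i) R0)).
pose q (i : I) (x : zmodule Q) : int^o :=
  (push (sub_val (quot_repr (x : Q))))@_(val i).
have qE i y : q i (proj _ y) = (push (sub_val y))@_(val i).
  have : quot_repr (proj (sub_in (chain 0%N) (chain 1%N)) y) - y \in
      sub_in (chain 0%N) (chain 1%N) by apply/proj_eqP; rewrite quot_reprK.
  rewrite inE /= inE raddfB subr_eq0 /q => /eqP -> //.
have qB i : zmod_morphism (q i).
  move=> x y; rewrite -[x]quot_reprK -[y]quot_reprK -(raddfB (proj _)) !qE.
  by rewrite !raddfB.
have q_lin i : linear (q i).
  move=> n x y; pose qa : {additive Q -> int} :=
    HB.pack (q i) (GRing.isZmodMorphism.Build Q int (q i) (qB i)).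
  have -> : n *: x + y = ((x : Q) *~ n + (y : Q) : Q) by [].
  rewrite -[LHS]/(qa _) raddfD raddfMz.
  by rewrite mulrzz mulrC.
pose k i : {linear zmodule Q -> int^o} :=
  HB.pack (q i) (GRing.isLinear.Build int (zmodule Q) int^o _ (q i) (q_lin i)).
have [|B BB _] := @has_dim_of_dual int (zmodule Q) I b k; last by exists B.
split=> [i j|x|x x0].
- rewrite -[k i (b j)]/(q i (b j)) /b qE /= raddfB /= !pushU.
  have [/andP[/eqP -> _] /andP[/eqP ri iR0]] := (valP j, valP i).
  rewrite /R0 rr mcoeffB !mcoeffU (inj_eq val_inj) [R0 == _]eq_sym (negPf iR0) subr0.
  by rewrite eq_sym.
- exists (pmap insub (msupp (push (sub_val (quot_repr (x : Q)))))) => i.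
  by rewrite mem_pmap_sub -mcoeff_neq0.
- set y := quot_repr (x : Q); pose z := push (sub_val y).
  have zsupp R : link_repr R != R -> z@_R = 0.
    move=> nR; rewrite /z /push /malg_extA /malg_ext raddf_sum /= big1 // => L _.
    rewrite mcoeffU; case: eqP => // LR.
    by move: nR; rewrite -LR rr eqxx.
  have zR R : R != R0 -> z@_R = 0.
    move=> RR0; have [rR|] := eqVneq (link_repr R) R; last exact: zsupp.
    have PR : P R by rewrite /P /= rR eqxx.
    exact: (x0 (exist _ R PR)).
  have zE : z = << z@_R0 *g R0 >>.
    apply/malgP => R; rewrite mcoeffU; case: (eqVneq R0 R) => [<- //|RR0].
    by rewrite mulr0n; apply: zR; rewrite eq_sym.
  have z0 : z@_R0 = 0.
    have : deg z = 0.
      by rewrite /z deg_push; have := sub_valP y; rewrite !inE => /eqP.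
    by rewrite {1}zE degU.
  apply/eqP; rewrite -[x]quot_reprK proj_eq0 !inE.
  by apply/eqP; apply: etrans zE _; rewrite z0 monalgU0.
Qed.

End ClassModule.

(** * Coefficients in a ring and the theorem *)

Section Coefficients.
Variables (F : unitRingType) (V : lmodType F) (r r' : Type).
Variables (A : pzRingType) (L0 : Gr r r' V).
Notation Grr := (Gr r r' V).

Lemma coef_mulU (c a : A) (L : Grr) : coef_mul c << a *g L >> = << c * a *g L >>.
Proof. by apply: malg_extU; rewrite mulr0 monalgU0. Qed.

Lemma coef_mulB (c : A) : zmod_morphism (@coef_mul Grr A c).
Proof.
by apply: malg_ext_is_additive => L x y; rewrite mulrBr monalgUB.
Qed.

(** It suffices to test the generators [[L] - [L t]] of M_1: for [b = c a] their
image is obtained from [a ([L] - [L t])] by left multiplication by [c]. *)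
Lemma tensor_to_malg_mem (S : zmodClosed {malg A[Grr]}) (a : A)
    (N : zmodClosed {malg int[Grr]}) :
  AG_submodule S -> {subset N <= kernel (push L0)} ->
  (forall L t, is_reflection t -> << a *g L >> - << a *g gr_act L t >> \in S) ->
  forall t : tensor (sub_of (left_ideal a)) (sub_of N), tensor_to_malg t \in S.
Proof.
move=> [_ Smul _] NK aS t; apply: tensor_lift_mem => [|b m].
  split=> [m x y|b x y] /=.
    rewrite /malg_ext -sumrB; apply: eq_bigr => L _.
    by rewrite mulrzBl monalgUB.
  by apply: malg_ext_is_additive => L k l; rewrite mulrzBr monalgUB.
have /asboolP[c bE] := sub_valP b.
pose f : {additive _ -> _} := malg_extA (fun L : Grr =>
  (mkmalgU L \o intmul (sub_val b)) : {additive int -> {malg A[Grr]}}).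
have fU k L : f << k *g L >> = << sub_val b *g L >> *~ k.
  apply: etrans (malg_extAU _ _ _) _ => /=; exact: raddfMz.
apply: (kernel_push_ind (f := f) (U := S) _ (NK _ (sub_valP m))) => k L g gr.
rewrite !fU -mulrzBl rpredMz // bE -!coef_mulU -coef_mulB; apply: Smul.
exact: aS.
Qed.

End Coefficients.

Unset Implicit Arguments.

Theorem theorem4p3 (F : unitRingType) (p : nat) (r r' : Type)
    (V : lmodType F)
    (F_div : forall x : F, x != 0 -> x \is a GRing.unit)
    (F_char : forall k : nat, (k%:R == 0 :> F) = (p %| k)%N)
    (F_inf : infinite_set [set: F])
    (r_gt0 : inhabited r) (r'_gt0 : inhabited r')
    (dimV : has_dim V (r + r')%type) :
  exists (M : nat -> zmodClosed {malg int[Gr r r' V]})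
         (M_dec : forall n, {subset M n.+1 <= M n}),
    [/\ M 0%N =i degree0 (T := Gr r r' V) (A := int),
        forall n, GL_stable (M n),
        forall n, exists2 x, x \in M n & x != 0
      & [/\ free_abelian (quot (sub_in (M 0%N) (M 1%N)))
              /\ ((forall x : quot (sub_in (M 0%N) (M 1%N)), x = 0) <->
                  finite_set [set: r] \/ finite_set [set: r']),
            (0 < p)%N -> forall (n : nat) (n_ge1 : (1 <= n)%N)
                (y : tensor (sub_of (Zinv p)) (sub_of (M 1%N))),
              exists x : tensor (sub_of (Zinv p)) (sub_of (M n)),
                tensor_map (sub_incl (chain_subset M_dec n_ge1)) x = y,
            forall (n : nat) (n_ge1 : (1 <= n)%N) (K : fieldType)
                (y : tensor K (sub_of (M 1%N))),
              exists x : tensor K (sub_of (M n)),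
                tensor_map (sub_incl (chain_subset M_dec n_ge1)) x = y
          & forall N : nat, exists n : nat,
              forall (A : pzRingType) (S : zmodClosed {malg A[Gr r r' V]})
                (a : 'I_N.+1 -> A) (L : 'I_N.+1 -> Gr r r' V),
              AG_submodule S ->
              \sum_(i < N.+1) << a i *g L i >> \in S ->
              ~ ([set` gr_space (L ord0)] `<=`
                 \bigcup_(i in [set j | j != ord0]) [set` gr_space (L i)]) ->
              forall t : tensor (sub_of (left_ideal (a ord0))) (sub_of (M n)),
                tensor_to_malg t \in S]].
Proof.
have [L0] := gr_inhabited dimV.
exists (chain L0), (@chain_dec _ _ _ _ L0); split.
- exact: chain0.
- exact: chain_stable.
- move=> n; have [t tr tL] := reflection_moves F_div dimV L0 r_gt0 r'_gt0.
  exists (fgen L0 - fgen (gr_act L0 t)).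
    case: n => [|n]; first exact: diff_deg0.
    by apply: linked_diff_mem; apply: rst_step; exists t.
  by rewrite subr_eq0 (inj_eq (@fgen_inj _)) eq_sym.
split.
- split; first exact: quot_chain_free.
  split=> [Q0|fin].
    apply: contrapT => /not_orP[rinf r'inf].
    have [L [L' nLL']] := unlinked_exist dimV rinf r'inf.
    apply: nLL'; exact: (@quot_chain_nontrivial _ _ _ _ L0).
  apply: quot_chain_trivial => L L'; case: fin => fin.
    exact: linked_finite_dim.
  exact: linked_finite_codim.
- move=> _ [//|n] n_ge1 y; exists y; apply: tensor_map_id => x; exact: val_inj.
- move=> [//|n] n_ge1 K y; exists y; apply: tensor_map_id => x; exact: val_inj.
move=> N; exists 1%N => A S a L SP alphaS L0P.
apply: (tensor_to_malg_mem SP) => [x|L1 t tr]; first exact: id.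
have [_ _ S_stable] := SP.
exact: (extract_linked F_div F_inf _ dimV r_gt0 S_stable alphaS L0P tr).
Qed.
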